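(* For all integers $r\geqslant 3$ and $k\geqslant 3$ there exists a constant $c=c(r,k)$ such that for every integer $n\geqslant 2$: $$|\mathrm{Forb}_r(n,C_k)|<\begin{cases}2^{c\,n^{2}} & \text{if } r=3 \text{ and } k \text{ is even},\\ 2^{c\,n^{r-1}(\log n)^{(r-3)/(r-2)}} & \text{if } r>3.\end{cases}$$
   Context: An $r$-graph on a vertex set $X$ is a collection of $r$-element subsets (edges) of $X$. For $k\geqslant 3$, the (loose) $k$-cycle $C_k$ (in the $r$-uniform setting) is an $r$-graph with distinct edges $e_1,\dots,e_k$ and distinct vertices $v_1,\dots,v_k$ such that $e_i\cap e_{i+1}=\{v_i\}$ for $1\leqslant i\leqslant k-1$, $e_1\cap e_k=\{v_k\}$, and $e_i\cap e_j=\emptyset$ for all other pairs $i\neq j$. For an $r$-graph $F$, $\mathrm{Forb}_r(n,F)$ denotes the set of $r$-graphs with vertex set $[n]=\{1,\dots,n\}$ that contain no copy of $F$ as a (not necessarily induced) subgraph. All logarithms are base 2. *)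

(* Defs.v *)
From HB Require Import structures.
From mathcomp Require Import all_boot all_order all_algebra.
From mathcomp Require Import reals exp.

Set Implicit Arguments.
Unset Strict Implicit.
Unset Printing Implicit Defensive.

Import Order.TTheory GRing.Theory Num.Theory.

Local Open Scope ring_scope.

Definition rgraph (V : finType) (r : nat) (H : {set {set V}}) : bool :=
  [forall e in H, #|e| == r].

(* Indices live in 'I_k, with [ordS] the cyclic successor, so the condition
   e_i :&: e_(i+1) = {v_i} also covers the closing pair (e_k, e_1). *)
Definition loose_cycle (V : finType) (r k : nat) (C : {set {set V}}) : bool :=
  rgraph r C &&
  [exists e : {ffun 'I_k -> {set V}}, [exists v : {ffun 'I_k -> V},
    [&& injectiveb e, injectiveb v, C == [set e i | i : 'I_k],
        [forall i, e i :&: e (ordS i) == [set v i]]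
      & [forall i, forall j,
          [&& i != j, j != ordS i & i != ordS j] ==>
            (e i :&: e j == set0)]]]].

(* The forbidden r-graph is given by the predicate [isF] recognizing its
   copies; the vertex set [n] is 'I_n. *)
Definition Forb (r n : nat) (isF : pred {set {set 'I_n}}) :
    {set {set {set 'I_n}}} :=
  [set H | rgraph r H & ~~ [exists C : {set {set 'I_n}}, (C \subset H) && isF C]].

Definition log2 (R : realType) (x : R) : R := ln x / ln 2.

(* Main.v *)
Require Import Defs.
From HB Require Import structures.
From mathcomp Require Import all_boot all_order all_algebra.
From mathcomp Require Import reals exp.
From mathcomp Require Import zify ring boolp.

(** Write q = r - 1.  Every nonempty r-graph without C_k has an edge e and a
vertex x of e such that e - x lies in boundedly many edges: otherwise C_k is
found greedily, by stretching a triangle of pairs to a k-cycle of pairs and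
moving the other vertices of the edges out of the way.  Peeling off such sets
writes a C_k-free r-graph as a union of boundedly many graphs of pairs
e + chi(e), where chi is a partial colouring of the q-sets by vertices, and it
remains to count the colourings chi for which this r-graph is C_k-free.

Such a colouring is counted box by box, a box being a complete q-partite
q-graph with parts of size s inside the support of chi.  A positive proportion
of the edges of a box have their colour on a list of bounded length attached to
one of the q s^(q-1) subsets of size q - 1: for q > 2 by the same greedy
argument, made rainbow; for q = 2 and k even because otherwise a random closed
walk of length k in the box is a rainbow cycle.  These edges therefore cost
O(1 + log n / s) bits each.  By the Kovari-Sos-Turan-Erdos argument a q-graph of
density 2^-j contains a box with s^(q-1) of order log n / j^(q-1), and the cost,
of order j (log n)^((q-2)/(q-1)) per edge, sums to
O(n^q (log n)^((q-2)/(q-1))) because only n^q / 2^j edges are removed at density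
at most 2^-j. *)

Set Implicit Arguments.
Unset Strict Implicit.
Unset Printing Implicit Defensive.

(** * Loose cycles and the greedy embedding *)

Lemma ordS_neq k (i : 'I_k) : 1 < k -> ordS i != i.
Proof.
move=> k1; apply/eqP => /(congr1 val) /=.
case: (ltngtP i.+1 k) (ltn_ord i) => // [lt|eq] _.
  by rewrite modn_small //; lia.
by rewrite eq modnn; lia.
Qed.

Lemma ordS2_neq k (i : 'I_k) : 2 < k -> ordS (ordS i) != i.
Proof.
move=> k2; apply/eqP => /(congr1 val) /=.
rewrite -addn1 modnDml addn1.
case: (ltngtP i.+2 k) (ltn_ord i) => [lt|gt|eq] ik.
- by rewrite modn_small //; lia.
- have -> : i.+2 = k + 1 by lia.
  by rewrite modnDl modn_small; lia.
- by rewrite eq modnn; lia.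
Qed.

(** By symmetry in [i] and [j], the last hypothesis makes a common vertex of two edges an endpoint,
    on [w], of both; injectivity of [w] then makes the edges cyclically consecutive. *)
Lemma loose_cycle_core (V : finType) r k (w : 'I_k -> V) (e : 'I_k -> {set V}) :
  2 < k -> injective w -> (forall i, #|e i| = r) ->
  (forall i, w i \in e i) -> (forall i, w (ordS i) \in e i) ->
  (forall i j x, i != j -> x \in e i -> x \in e j ->
     (x == w i) || (x == w (ordS i))) ->
  loose_cycle r k [set e i | i : 'I_k].
Proof.
move=> k2 wI er we we' cap.
have capE i j x : i != j -> x \in e i -> x \in e j ->
    [|| (i == ordS j) && (x == w i) | (j == ordS i) && (x == w j)].
  move=> ij xi xj; have := cap _ _ _ ij xi xj.
  have := cap j i x; rewrite eq_sym ij => /(_ isT xj xi).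
  have ji : (j == i) = false by rewrite eq_sym (negbTE ij).
  case/orP=> /eqP->; rewrite !(inj_eq wI) ?(inj_eq (@ordS_inj _)) ?eqxx ?ji //=.
    by rewrite andbT => ->; rewrite orbT.
  by rewrite orbF eq_sym => /eqP->; rewrite eqxx.
apply/andP; split.
  by apply/forall_inP => _ /imsetP[i _ ->]; rewrite er.
apply/existsP; exists [ffun i => e i]; apply/existsP.
(* [e i] runs from [w i] to [w (ordS i)], so it meets the next edge in [w (ordS i)]: the core is
   shifted by one. *)
exists [ffun i => w (ordS i)].
apply/and5P; split.
- apply/injectiveP => i j; rewrite !ffunE => eij.
  apply/eqP; apply: contraT => ij.
  have k1 := ltnW k2.
  have xi := we i; rewrite eij in xi.
  have xi' := we' i; rewrite eij in xi'.
  have /orP[/andP[/eqP ij' _]|/andP[_]] := capE _ _ _ ij (we i) xi; last first.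
    by rewrite (inj_eq wI) (negbTE ij).
  have /orP[/andP[_]|/andP[/eqP ji' _]] := capE _ _ _ ij (we' i) xi'.
    by rewrite (inj_eq wI) (negbTE (ordS_neq _ k1)).
  by have := ordS2_neq i k2; rewrite -ji' -ij' eqxx.
- by apply/injectiveP => i j; rewrite !ffunE => /wI /ordS_inj.
- by apply/eqP/eq_imset => i; rewrite ffunE.
- apply/forallP => i; rewrite !ffunE; apply/eqP/setP => x; rewrite !inE.
  apply/andP/eqP => [[xi xj]|->]; last by rewrite we' we.
  have := capE i (ordS i) x; rewrite eq_sym ordS_neq 1?ltnW // => /(_ isT xi xj).
  by rewrite eq_sym (negbTE (ordS2_neq _ k2)) eqxx /= => /eqP.
- apply/forallP => i; apply/forallP => j; apply/implyP => /and3P[ij jS iS].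
  rewrite !ffunE; apply/eqP/setP => x; rewrite !inE; apply/negP => /andP[xi xj].
  by have := capE _ _ _ ij xi xj; rewrite (negbTE jS) (negbTE iS).
Qed.

(* [iota] names the colour attached to a vertex; a strongly rainbow cycle uses
   neither a colour twice nor a colour attached to one of its vertices. *)
Definition rainbow_cycle (V Z : finType) (iota : V -> Z) (chi : {set V} -> Z)
    (K : {set {set V}}) k :=
  exists w : 'I_k -> V, exists e : 'I_k -> {set V},
    [/\ injective w,
        forall i, [/\ e i \in K, w i \in e i & w (ordS i) \in e i],
        forall i j x, i != j -> x \in e i -> x \in e j ->
          (x == w i) || (x == w (ordS i)),
        forall i j, i != j -> chi (e i) != chi (e j)
      & forall i j x, x \in e j -> chi (e i) != iota x].

Definition colors (V Z : finType) (chi : {set V} -> Z) (K : {set {set V}}) (f : {set V}) :=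
  chi @: [set e in K | f \subset e].

(** * Greedy construction of a rainbow cycle *)

Section Greedy.
Variables (V Z : finType) (iota : V -> Z) (chi : {set V} -> Z).
Variables (K : {set {set V}}) (q D : nat).
Hypothesis iotaI : injective iota.
Hypothesis q2 : 2 < q.
Hypothesis Kq : forall e, e \in K -> #|e| = q.
Hypothesis chi_out : forall e x, e \in K -> x \in e -> chi e != iota x.
Hypothesis Kfull : forall e x, e \in K -> x \in e ->
  D < #|colors chi K (e :\ x)|.

(** More than [D] colours occur around [e :\ x]. Those in [T] are excluded and each vertex of [S]
    accounts for at most one colour, so another colour is left. *)
Lemma swap_vertex e x (S : {set V}) (T : {set Z}) :
  e \in K -> x \in e -> #|S| + #|T| <= D ->
  exists y, [/\ y \notin S, y |: (e :\ x) \in K & chi (y |: (e :\ x)) \notin T].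
Proof.
move=> eK xe ST.
have [/existsP[y /and3P[*]]|no] := boolP [exists y, [&& y \notin S,
  y |: (e :\ x) \in K & chi (y |: (e :\ x)) \notin T]]; first by exists y.
have sub : colors chi K (e :\ x) \subset
    T :|: [set chi (y |: (e :\ x)) | y in S].
  apply/subsetP => _ /imsetP[e' /[!inE] /andP[e'K sub] ->].
  have : 0 < #|e' :\: (e :\ x)|.
    rewrite cardsD (setIidPr sub) subn_gt0 (Kq e'K) -(Kq eK).
    by rewrite (cardsD1 x e) xe.
  rewrite card_gt0 => /set0Pn[y /setDP[ye' yn]].
  have e'E : e' = y |: (e :\ x).
    apply/esym/eqP; rewrite eqEcard subUset sub1set ye' sub /=.
    by rewrite cardsU1 yn (Kq e'K) -(Kq eK) (cardsD1 x e) xe.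
  move/existsPn: no => /(_ y); rewrite -e'E e'K /=.
  case yS: (y \in S); last by rewrite /= negbK => ->.
  by rewrite e'E => _; rewrite imset_f ?orbT.
have := leq_trans (Kfull eK xe) (subset_leq_card sub).
move=> /leq_trans/(_ (leq_card_setU _ _)) .
by have := leq_imset_card (fun y => chi (y |: (e :\ x))) S; lia.
Qed.

(** Vertices of [e] in [S], other than [x] and [y], are swapped one at a time for vertices outside
    [S]. Since [q > 2], a vertex off the pair remains for a last swap, which brings the colour out
    of [T]. *)
Lemma extend_pair e x y (S : {set V}) (T : {set Z}) :
  e \in K -> x \in e -> y \in e -> #|S| + #|T| <= D ->
  exists e', [/\ e' \in K, x \in e', y \in e', chi e' \notin T
    & forall z, z \in e' -> z \in S -> (z == x) || (z == y)].
Proof.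
move=> + + + ST; move: {2}_.+1 (ltnSn #|(e :\: [set x; y]) :&: S|) => m.
elim: m e => // m IHm e le eK xe ye.
have ex : exists2 u, u \in e :\: [set x; y] &
    (u \in S) \/ (e :\: [set x; y]) :&: S = set0.
  have [e0|/set0Pn[u /setIP[ue uS]]] := eqVneq ((e :\: [set x; y]) :&: S) set0;
    last by exists u => //; left.
  have : 0 < #|e :\: [set x; y]|.
    rewrite cardsD subn_gt0 (Kq eK) (leq_ltn_trans _ q2) //.
    rewrite (leq_trans (subset_leq_card (subsetIr _ _))) //.
    by rewrite cards2; case: (x == y).
  by rewrite card_gt0 => /set0Pn[u ue]; exists u => //; right.
case: ex => u /[!inE] /andP[/norP[ux uy] ue] uS.
have [v [vS vK vT]] := swap_vertex eK ue ST.
have xe' : x \in v |: (e :\ u) by rewrite !inE (eq_sym x u) ux xe orbT.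
have ye' : y \in v |: (e :\ u) by rewrite !inE (eq_sym y u) uy ye orbT.
have [e0|ne] := eqVneq ((e :\: [set x; y]) :&: S) set0.
  exists (v |: (e :\ u)); split=> // z /[!inE] /orP[/eqP-> vS'|/andP[_ ze] zS].
    by rewrite vS' in vS.
  apply: contraT => nxy; move/setP/(_ z): e0; rewrite !inE.
  by rewrite nxy ze zS.
apply: (IHm (v |: (e :\ u))) => //.
apply: leq_trans (_ : #|(e :\: [set x; y]) :&: S| <= _); last by lia.
apply: proper_card; apply/properP; split.
  apply/subsetP => z /[!inE] /andP[/andP[-> /orP[/eqP->|/andP[_ ->]]] zS] //.
  by rewrite zS in vS.
case: uS => [uS|e0]; last by rewrite e0 eqxx in ne.
exists u; first by rewrite !inE !negb_or ux uy ue uS.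
apply/negP; rewrite !inE eqxx andFb orbF => /andP[/andP[_ /eqP uv] _].
by rewrite -uv uS in vS.
Qed.

Definition linked x y := [exists e in K, (x \in e) && (y \in e)].

(* A cycle of linked pairs grows by inserting between two neighbours a new
   vertex of an edge through both of them. *)
Lemma core_cycle k : 2 < k -> k <= D -> K != set0 ->
  exists2 p : seq V, size p = k & uniq p && cycle linked p.
Proof.
move=> + + /set0Pn[e eK].
have linkedI e' x y : e' \in K -> x \in e' -> y \in e' -> linked x y.
  by move=> *; apply/exists_inP; exists e' => //; apply/andP.
elim: k => // k IHk; rewrite ltnS leq_eqVlt => /orP[/eqP<- _|k2 kD].
  (* The base case is a triangle: three vertices of one edge are pairwise linked. *)
  have := Kq eK; rewrite cardE; have := enum_uniq e; have ein := mem_enum e.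
  case: (enum e) ein => [|a [|b [|c s]]] ein U sq; try by move: sq q2 => /= <-.
  have [ae be ce] : [/\ a \in e, b \in e & c \in e].
    by rewrite -!ein !inE !eqxx ?orbT.
  exists [:: a; b; c] => //; apply/andP; split.
    move: U => /= /and4P[]; rewrite !inE !negb_or => /and3P[-> -> _].
    by case/andP=> ->.
  by rewrite /= !(linkedI e).
have [[|x [|y p]] sp] := IHk k2 (ltnW kD); try by move: k2; rewrite -sp.
move=> /andP[U]; rewrite [cycle _ _]/= => /andP[/exists_inP[e' e'K /andP[xe ye]] P].
have ST : #|[set z in x :: y :: p]| + #|@set0 Z| <= D.
  rewrite cards0 addn0 cardsE; apply: leq_trans (card_size _) _.
  by rewrite sp ltnW.
have [e2 [e2K xe2 ye2 _ e2S]] := extend_pair e'K xe ye ST.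
have : 0 < #|e2 :\: [set x; y]|.
  rewrite cardsD subn_gt0 (Kq e2K) (leq_ltn_trans _ q2) //.
  rewrite (leq_trans (subset_leq_card (subsetIr _ _))) //.
  by rewrite cards2; case: (x == y).
rewrite card_gt0 => /set0Pn[z /[!inE] /andP[nz ze]].
have zn : z \notin [:: x, y & p].
  by apply: contra nz => zp; apply: e2S; rewrite ?inE.
exists [:: x, z, y & p]; first by rewrite /= -sp.
apply/andP; split.
  move: U zn => /=; rewrite !inE !negb_or => /andP[/andP[xy xp] ->].
  by case/and3P=> zx -> ->; rewrite (eq_sym x z) zx xy xp.
by rewrite [cycle _ _]/= (linkedI e2) // (linkedI e2).
Qed.

(** The pairs of the cycle [w] are completed to edges one by one, the first [m] being done. Off its
    pair, each new edge avoids the whole cycle and all earlier edges. *)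
Lemma rainbow_edges k (w : 'I_k -> V) m : m <= k ->
  2 * (k * q.+2) <= D -> injective w ->
  (forall i, linked (w i) (w (ordS i))) ->
  exists e : 'I_k -> {set V},
    [/\ forall i : 'I_k, i < m -> [/\ e i \in K, w i \in e i & w (ordS i) \in e i],
        forall (i j : 'I_k), i < m -> w j \in e i ->
          (w j == w i) || (w j == w (ordS i)),
        forall (i j : 'I_k), i < m -> j < m -> i != j ->
          chi (e i) != chi (e j) /\
          (forall x, x \in e i -> x \in e j -> x \in codom w),
        forall i j : 'I_k, i < m -> chi (e i) != iota (w j)
      & forall (i j : 'I_k) x, i < m -> j < m -> x \in e j -> chi (e i) != iota x].
Proof.
move=> + kD wI wL; elim: m => [|m IHm] mk; first by exists (fun=> set0); split.
have [e [eK ew ee ec ex]] := IHm (ltnW mk); pose i0 := Ordinal mk.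
have /exists_inP[e0 e0K /andP[we0 we0']] := wL i0.
pose U := [set w i | i : 'I_k] :|: \bigcup_(i < k | i < m) e i.
pose C := [set chi (e i) | i : 'I_k & i < m].
have cardU : #|U| <= k + k * q.
  apply: leq_trans (leq_card_setU _ _) _; apply: leq_add.
    by apply: leq_trans (leq_imset_card _ _) _; rewrite card_ord.
  apply: leq_trans (_ : \sum_(i < k | i < m) #|e i| <= _).
    elim/big_rec2: _ => [|i y s _ le]; first by rewrite cards0.
    by apply: leq_trans (leq_card_setU _ _) _; rewrite leq_add2l.
  apply: leq_trans (_ : \sum_(i < k | i < m) q <= _).
    by apply: leq_sum => i /eK[eiK _ _]; rewrite (Kq eiK).
  apply: leq_trans (_ : \sum_(i < k) q <= _); last by rewrite sum_nat_const card_ord.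
  by rewrite big_mkcond; apply: leq_sum => i _; case: ifP.
have cardC : #|C| <= k.
  by rewrite -[k in _ <= k]card_ord; apply: leq_trans (leq_imset_card _ _) (max_card _).
have inC (i : 'I_k) : i < m -> chi (e i) \in C.
  by move=> im; apply/imsetP; exists i; rewrite ?inE.
(* [U] holds the vertices and [C] the colours used so far. Colours attached to [U] and vertices
   whose attached colour is in [C] are forbidden as well, which doubles the count
   [k + k * q + k]. *)
have ST : #|U :|: iota @^-1: C| + #|C :|: iota @: U| <= D.
  have h1 := leq_card_setU U (iota @^-1: C).
  have h2 := leq_card_setU C (iota @: U).
  have h3 : #|iota @: U| <= #|U| := leq_imset_card _ _.
  have h4 : #|iota @^-1: C| <= #|C|.
    rewrite -(card_imset _ iotaI).
    by apply/subset_leq_card/subsetP => _ /imsetP[x /[!inE] + ->].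
  apply: leq_trans (leq_add h1 h2) _; apply: leq_trans kD.
  apply: leq_trans (_ : (#|U| + #|C|) + (#|C| + #|U|) <= _).
    by rewrite leq_add // leq_add2l.
  by rewrite !mulnS mul2n -addnn leq_add //; lia.
have [f [fK wf wf' fT fS]] := extend_pair e0K we0 we0' ST.
have wU i : w i \in U by rewrite inE imset_f.
have eU (i : 'I_k) x : i < m -> x \in e i -> x \in U.
  by move=> im xe; rewrite inE; apply/orP; right; apply/bigcupP; exists i.
have fc x : x \in U -> chi f != iota x.
  move=> xU; apply: contraNneq fT => ->.
  by rewrite inE imset_f ?orbT.
have fe (i : 'I_k) : i < m -> chi f != chi (e i).
  by move=> im; apply: contraNneq fT => ->; rewrite inE inC.
have fcore x : x \in f -> x \in U -> x \in codom w.
  move=> xf xU; have := fS x xf; rewrite inE xU => /(_ isT).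
  by case/orP=> /eqP->; apply: codom_f.
have efx (i : 'I_k) x : i < m -> x \in f -> chi (e i) != iota x.
  move=> im xf; apply/eqP => eq.
  have := fS x xf; rewrite !in_setU [_ \in iota @^-1: C]inE -eq inC // orbT => /(_ isT).
  by case/orP=> /eqP xw; have := ec i; rewrite eq xw => /(_ _ im) /eqP; apply.
exists (fun i => if i == i0 then f else e i).
have ltm (i : 'I_k) : i < m.+1 -> i == i0 \/ (i == i0 = false /\ i < m).
  rewrite ltnS leq_eqVlt => /orP[im|im]; first by left.
  by right; split=> //; apply/negbTE; rewrite -val_eqE /= neq_ltn im.
split.
- by move=> i /ltm[/eqP->|[-> /eK]]; rewrite ?eqxx.
- move=> i j /ltm[/eqP->|[-> im]]; last exact: ew.
  by rewrite eqxx => wjf; apply: fS => //; rewrite inE wU.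
- move=> i j /ltm[/eqP->|[ni im]] /ltm[/eqP->|[nj jm]]; rewrite ?eqxx ?ni ?nj //.
  + by move=> _; split=> [|x xf /(eU _ _ jm)]; [apply: fe | apply: fcore].
  + by move=> _; split=> [|x /(eU _ _ im) xU xf]; [rewrite eq_sym fe | apply: fcore].
  + exact: ee.
- by move=> i j /ltm[/eqP->|[-> im]]; rewrite ?eqxx ?ec // fc.
- move=> i j x /ltm[/eqP->|[ni im]] /ltm[/eqP->|[nj jm]]; rewrite ?eqxx ?ni ?nj.
  + exact: chi_out.
  + by move=> /(eU _ _ jm); apply: fc.
  + by apply: efx.
  + exact: ex.
Qed.

Lemma full_rainbow_cycle k : 2 < k -> 2 * (k * q.+2) <= D -> K != set0 ->
  rainbow_cycle iota chi K k.
Proof.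
move=> k2 kD K0.
have kD' : k <= D by rewrite (leq_trans _ kD) // !mulnS; lia.
have [p sp /andP[U C]] := core_cycle k2 kD' K0.
have x0 : V by case: p sp {U C} k2 => [<-|].
pose w (i : 'I_k) := nth x0 p i.
have wI : injective w.
  by move=> i j /eqP; rewrite nth_uniq ?sp // => /eqP/val_inj.
have wL i : linked (w i) (w (ordS i)).
  rewrite /w; have -> : nth x0 p (ordS i) = next p (nth x0 p i).
    rewrite next_nth mem_nth ?sp // index_uniq ?sp //.
    case: p sp U {C w wI} => [|y p] sp U; first by exfalso; move: k2; rewrite -sp.
    have sp' : (size p).+1 = k := sp.
    rewrite /=; have [lt|ge] := ltnP i.+1 k.
      by rewrite modn_small //=; apply: set_nth_default; rewrite -ltnS sp'.
    have -> : i.+1 = k by apply/eqP; rewrite eqn_leq ge ltn_ord.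
    by rewrite modnn (@nth_default _ y) // -ltnS sp'.
  by apply: next_cycle C _; rewrite mem_nth ?sp.
have [e [eK ew ee ec ex]] := rainbow_edges (leqnn k) kD wI wL.
exists w, e; split=> //.
- by move=> i; apply: eK.
- move=> i j x ij xi xj.
  have [_ /(_ x xi xj)/codomP[l xl]] := ee i j (ltn_ord i) (ltn_ord j) ij.
  by rewrite xl; apply: ew => //; rewrite -xl.
- by move=> i j ij; have [] := ee i j (ltn_ord i) (ltn_ord j) ij.
- by move=> i j x; apply: ex.
Qed.

End Greedy.

(** * Avoiding rare events *)

Section RareEvents.
Variables k s D : nat.
Implicit Types (w : {ffun 'I_k -> 'I_s}) (B : pred {ffun 'I_k -> 'I_s}).

Definition upd w m x : {ffun 'I_k -> 'I_s} :=
  [ffun i => if i == m then x else w i].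

Lemma rare_count B m :
  (forall w, D * #|[set x | B (upd w m x)]| <= s) ->
  D * #|[set w | B w]| <= #|{ffun 'I_k -> 'I_s}|.
Proof.
move=> rare; have [s0|s0] := posnP s.
  rewrite (_ : [set w | B w] = set0) ?cards0 ?muln0 //.
  by apply/setP => w; exfalso; have := ltn_ord (w m); rewrite [X in _ < X]s0.
rewrite -(leq_pmul2l s0) mulnCA.
have -> : s * #|[set w | B w]| = \sum_w #|[set x | B (upd w m x)]|.
  (* [h] exchanges coordinate [m] of [w] with [x]. It is an involution, so resampling one coordinate
     of a uniform [w] leaves it uniform. *)
  pose h (p : {ffun 'I_k -> 'I_s} * 'I_s) := (upd p.1 m p.2, p.1 m).
  have hK : involutive h.
    move=> [w x]; rewrite /h /= !ffunE eqxx; congr pair.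
    by apply/ffunP => i; rewrite !ffunE; case: eqP => // ->.
  transitivity (\sum_w \sum_(x < s) (B w : nat)).
    rewrite -sum1_card big_mkcond big_distrr /=; apply: eq_bigr => w _.
    by rewrite sum_nat_const card_ord inE; case: (B w).
  transitivity (\sum_w \sum_(x < s) (B (upd w m x) : nat)).
    rewrite !pair_big (reindex_inj (inv_inj hK)) /=.
    by apply: eq_bigr.
  apply: eq_bigr => w _; rewrite -sum1_card [RHS]big_mkcond.
  by apply: eq_bigr => x _; rewrite inE; case: (B _).
rewrite big_distrr /=.
apply: leq_trans (_ : \sum_w s <= _); first exact: leq_sum.
by rewrite sum_nat_const mulnC.
Qed.

(* Union bound over a random [w]; rarity in a single coordinate, for every value
   of the others, makes an event have probability at most [1 / D]. *)
Lemma avoid_rare_events (P : finType) (B : P -> pred {ffun 'I_k -> 'I_s}) :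
  0 < s -> #|P| < D ->
  (forall p, exists m, forall w, D * #|[set x | B p (upd w m x)]| <= s) ->
  exists w, forall p, ~~ B p w.
Proof.
move=> s0 PD rare.
have [/existsP[w /forallP]|no] := boolP [exists w, forall p, ~~ B p w].
  by exists w.
have F0 : 0 < #|{ffun 'I_k -> 'I_s}|.
  by rewrite card_ffun card_ord expn_gt0 s0.
have : D * #|{ffun 'I_k -> 'I_s}| <= #|P| * #|{ffun 'I_k -> 'I_s}|.
  apply: leq_trans (_ : D * \sum_p #|[set w | B p w]| <= _).
    rewrite leq_mul2l; apply/orP; right.
    apply: leq_trans (_ : \sum_w \sum_p (B p w : nat) <= _).
      rewrite -sum1_card; apply: leq_sum => w _.
      move/existsPn: no => /(_ w) /forallPn[p /negPn Bp].
      by rewrite (bigD1 p) //= Bp.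
    rewrite exchange_big; apply: leq_sum => p _.
    rewrite -sum1_card [X in _ <= X]big_mkcond; apply: leq_sum => w _.
    by rewrite inE; case: (B p w).
  rewrite big_distrr /= -sum_nat_const; apply: leq_sum => p _.
  by have [m /rare_count] := rare p.
by rewrite leq_pmul2r // leqNgt PD.
Qed.

End RareEvents.

(** * Boxes *)

(** A complete [q]-partite [q]-graph, built one part at a time; the condition [x \notin f] keeps the
    new part [X] away from the earlier ones. *)
Fixpoint is_box (V : finType) s q (K : {set {set V}}) : Prop :=
  if q is q'.+1 then
    exists X : {set V}, exists K' : {set {set V}},
      [/\ #|X| = s, is_box s q' K', forall x f, x \in X -> f \in K' -> x \notin f
        & K = [set x |: f | x in X, f in K']]
  else K = [set set0].

Definition shadow (V : finType) (K : {set {set V}}) : {set {set V}} :=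
  \bigcup_(e in K) [set e :\ x | x in e].

Lemma card_box (V : finType) s q (K : {set {set V}}) :
  is_box s q K -> #|K| = s ^ q.
Proof.
elim: q K => [|q IHq] K /=; first by move=> ->; rewrite cards1.
move=> [X [K' [Xs /IHq K's XK ->]]].
rewrite curry_imset2X card_in_imset ?cardsX ?Xs ?K's ?expnS //.
move=> [x f] [y g] /setXP[/= xX fK] /setXP[/= yX gK] eq.
have xy : x = y.
  have := setU11 x f; rewrite eq !inE => /orP[/eqP //|xg].
  by rewrite (negPf (XK _ _ xX gK)) in xg.
congr pair => //; apply/setP => z; move/setP/(_ z): eq; rewrite !inE -xy.
case: eqP => // -> _; rewrite (negPf (XK _ _ xX fK)).
by rewrite xy (negPf (XK _ _ yX gK)).
Qed.

Lemma box_uniform (V : finType) s q (K : {set {set V}}) e :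
  is_box s q K -> e \in K -> #|e| = q.
Proof.
elim: q K e => [|q IHq] K e /=; first by move=> -> /set1P->; rewrite cards0.
move=> [X [K' [_ K's XK ->]]] /imset2P[x f xX fK ->].
by rewrite cardsU1 (XK _ _ xX fK) (IHq _ _ K's fK).
Qed.

(** Deleting the vertex of the newest part leaves an edge of the smaller box; deleting another one
    leaves that vertex added to a set of the smaller shadow. *)
Lemma card_shadow_box (V : finType) s q (K : {set {set V}}) :
  is_box s q K -> #|shadow K| <= q * s ^ q.-1.
Proof.
elim: q K => [|q IHq] K /=.
  move=> ->; rewrite mul0n leqn0 cards_eq0; apply/eqP/setP => f; rewrite inE.
  by apply/negP => /bigcupP[e /set1P->] /imsetP[x]; rewrite inE.
move=> [X [K' [Xs boxK' XK ->]]].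
have sub : shadow [set x |: f | x in X, f in K'] \subset
    K' :|: [set x |: f | x in X, f in shadow K'].
  apply/subsetP => g /bigcupP[_ /imset2P[x f xX fK ->]] /imsetP[y yf ->].
  move: yf; rewrite !inE => /predU1P[->|yf].
    by rewrite setU1K ?fK // (XK _ _ xX fK).
  apply/orP; right; apply/imset2P; exists x (f :\ y) => //.
    by apply/bigcupP; exists f => //; apply: imset_f.
  apply/setP => z; rewrite !inE; case: (eqVneq z x) => //= ->.
  by rewrite andbT; apply: contraNneq (XK _ _ xX fK) => ->.
apply: leq_trans (subset_leq_card sub) _.
apply: leq_trans (leq_card_setU _ _) _.
rewrite (card_box boxK') mulSn leq_add2l.
apply: leq_trans (_ : #|X| * #|shadow K'| <= _).
  by rewrite curry_imset2X -cardsX leq_imset_card.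
rewrite Xs; apply: leq_trans (leq_mul (leqnn s) (IHq _ boxK')) _.
by case: q {IHq boxK' sub} => [|q]; rewrite ?muln0 //= mulnCA -expnS.
Qed.

Lemma box_set1 (V : finType) q (e : {set V}) : #|e| = q -> is_box 1 q [set e].
Proof.
elim: q e => [|q IHq] e eq.
  by rewrite /=; move/eqP: eq; rewrite cards_eq0 => /eqP->.
have /set0Pn[x xe] : e != set0 by rewrite -card_gt0 eq.
have eq' : #|e :\ x| = q by move: eq; rewrite (cardsD1 x) xe; case.
exists [set x], [set e :\ x]; split.
- by rewrite cards1.
- exact: IHq.
- by move=> _ _ /set1P-> /set1P->; rewrite !inE eqxx.
- by rewrite imset2_set1l imset_set1 setD1K.
Qed.

(** * Rainbow cycles in bipartite boxes *)

Lemma odd_ordS k (i : 'I_k) : ~~ odd k -> odd (ordS i) = ~~ odd i.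
Proof.
move=> kE /=; case: (ltngtP i.+1 k) (ltn_ord i) => [lt|//|eq] _.
  by rewrite modn_small.
by have := congr1 odd eq; rewrite /= (negbTE kE) eq modnn => ->.
Qed.

Section Bipartite.
Variables (V : finType) (k s D : nat) (vert : bool -> 'I_s -> V).
Variables (chi : {set V} -> V) (U : {set {set V}}).
Hypothesis vertI : forall b b' a a', vert b a = vert b' a' -> b = b' /\ a = a'.
Hypothesis kE : ~~ odd k.
Hypothesis k2 : 2 < k.
Hypothesis kD : 5 * k ^ 2 < D.
Hypothesis Ds : D <= s.

(** The flag [b] tells on which side [a] lies; a closed walk of even length alternates it. *)
Definition bedge b a a' := [set vert b a; vert (~~ b) a'].

Hypothesis chi_out : forall b a a' x, x \in bedge b a a' -> chi (bedge b a a') != x.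
Hypothesis rareU : D ^ 2 * #|U| <= s ^ 2.
Hypothesis rare_color : forall b a a',  bedge b a a' \notin U ->
  D * #|[set x | chi (bedge b a x) == chi (bedge b a a')]| <= s.

Lemma bedgeC b a a' : bedge b a a' = bedge (~~ b) a' a.
Proof. by rewrite /bedge negbK setUC. Qed.

Lemma bedge_inj b a a' c c' : bedge b a a' = bedge b c c' -> (a, a') = (c, c').
Proof.
move=> eq; have : vert b a \in bedge b c c' by rewrite -eq !inE eqxx.
rewrite !inE => /orP[/eqP/vertI[_ ->]|/eqP/vertI[]]; last by case: b {eq}.
have : vert (~~ b) a' \in bedge b c c' by rewrite -eq !inE eqxx orbT.
by rewrite !inE => /orP[/eqP/vertI[]|/eqP/vertI[_ ->] //]; case: b {eq}.
Qed.

Definition bad b a := s < D * #|[set a' | bedge b a a' \in U]|.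

(** Markov's inequality: a bad vertex lies on more than [s / D] edges of [U], and [U] has at most
    [s ^ 2 / D ^ 2] edges. *)
Lemma rare_bad b : D * #|[set a | bad b a]| <= s.
Proof.
have s0 : 0 < s by lia.
rewrite -(leq_pmul2l s0) mulnn; apply: leq_trans rareU.
rewrite mulnCA -mulnn -mulnA leq_mul2l; apply/orP; right.
apply: leq_trans (_ : \sum_a D * #|[set a' | bedge b a a' \in U]| <= _).
  rewrite mulnC -sum_nat_const big_mkcond.
  by apply: leq_sum => a _; rewrite inE; case: ifP => // /ltnW.
rewrite -big_distrr leq_mul2l; apply/orP; right => /=.
pose h (p : 'I_s * 'I_s) := bedge b p.1 p.2.
apply: leq_trans (_ : #|[set h p | p in [set p | h p \in U]]| <= _).
  rewrite card_imset; last by move=> [? ?] [? ?] /bedge_inj.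
  rewrite (eq_bigr (fun a => \sum_a' (bedge b a a' \in U : nat))); last first.
    move=> a _; rewrite -sum1_card big_mkcond.
    by apply: eq_bigr => a' _; rewrite inE; case: (_ \in _).
  rewrite pair_bigA -sum1_card [X in _ <= X]big_mkcond.
  by apply: leq_sum => p _; rewrite inE; case: (_ \in _).
by apply/subset_leq_card/subsetP => _ /imsetP[p /[!inE] + ->].
Qed.

Let wedge (w : 'I_k -> 'I_s) (i : 'I_k) := bedge (odd i) (w i) (w (ordS i)).
Let wvert (w : 'I_k -> 'I_s) (i : 'I_k) := vert (odd i) (w i).

(* The walk [w] fails at positions [i], [j]: an endpoint with many covered edges,
   a covered edge, a repeated colour, a repeated vertex, a colour on the walk. *)
Let event (p : 'I_k * 'I_k * 'I_5) (w : {ffun 'I_k -> 'I_s}) : bool :=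
  let: (i, j, c) := p in
  match val c with
  | 0 => bad (odd i) (w i)
  | 1 => ~~ bad (odd i) (w i) && (wedge w i \in U)
  | 2 => [&& i != j, wedge w j \notin U & chi (wedge w i) == chi (wedge w j)]
  | 3 => (i != j) && (wvert w i == wvert w j)
  | _ => chi (wedge w i) == wvert w j
  end.

(** In each case one coordinate of the walk is resampled: for a covered edge the end other than the
    good vertex [w i], for a repeated vertex or a colour on the walk the vertex [j]. A colour never
    equals an endpoint of its own edge. *)
Lemma events_rare p :
  exists m, forall w, D * #|[set x | event p (upd w m x)]| <= s.
Proof.
have k1 := ltnW k2.
have updE w m x : upd w m x m = x by rewrite ffunE eqxx.
have updN w m x i : i != m -> upd w m x i = w i.
  by move=> im; rewrite ffunE (negPf im).
have le0 (A : {set 'I_s}) : (forall x, x \notin A) -> D * #|A| <= s.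
  move=> A0; rewrite (_ : A = set0) ?cards0 ?muln0 //.
  by apply/setP => x; rewrite [RHS]inE; apply/negbTE/A0.
have le1 (A : {set 'I_s}) (f : 'I_s -> V) v : injective f ->
    (forall x, x \in A -> f x = v) -> D * #|A| <= s.
  move=> fI Av; apply: leq_trans Ds; rewrite -[X in _ <= X]muln1 leq_mul2l.
  apply/orP; right; apply/card_le1_eqP => x y xA yA.
  by apply: fI; rewrite !Av.
have vI b : injective (vert b) by move=> x y /vertI[].
case: p => [[i j] [[|[|[|[|c]]]] c5]] /=.
- exists i => w; rewrite (eq_card (B := [set a | bad (odd i) a])) ?rare_bad //.
  by move=> x; rewrite !inE updE.
- exists (ordS i) => w.
  have [bi|bi] := boolP (bad (odd i) (w i)).
    by apply: le0 => x; rewrite inE updN ?bi // eq_sym ordS_neq.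
  rewrite -leqNgt in bi; apply: leq_trans bi; rewrite leq_mul2l; apply/orP; right.
  apply/subset_leq_card/subsetP => x; rewrite !inE /wedge => /andP[_].
  by rewrite updE updN // eq_sym ordS_neq.
- have [->|ij] := eqVneq i j; first by exists j => w; apply: le0 => x; rewrite inE.
  (* The coordinate to resample must be an end of edge [j] but not of edge [i]: it is [ordS j],
     unless edge [i] starts there, and then it is [j]. *)
  have [eiSj|niSj] := eqVneq i (ordS j).
    exists j => w.
    have E x : wedge (upd w j x) j = bedge (~~ odd j) (w (ordS j)) x.
      by rewrite /wedge updE updN ?ordS_neq // bedgeC.
    have E' x : wedge (upd w j x) i = wedge w i.
      by rewrite /wedge !updN // eiSj ordS2_neq.
    set A := [set x | _]; have [A0|[x xA]] := set_0Vmem A.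
      by rewrite A0 cards0 muln0.
    move: (xA); rewrite inE /= E E' => /andP[nU /eqP cE].
    apply: leq_trans (rare_color nU); rewrite leq_mul2l; apply/orP; right.
    by apply/subset_leq_card/subsetP => y; rewrite !inE /= E E' cE => /andP[_ /eqP->].
  exists (ordS j) => w.
  have E x : wedge (upd w (ordS j) x) j = bedge (odd j) (w j) x.
    by rewrite /wedge updE updN // eq_sym ordS_neq.
  have E' x : wedge (upd w (ordS j) x) i = wedge w i.
    by rewrite /wedge !updN // (inj_eq (@ordS_inj k)).
  set A := [set x | _]; have [A0|[x xA]] := set_0Vmem A.
    by rewrite A0 cards0 muln0.
  move: (xA); rewrite inE /= E E' => /andP[nU /eqP cE].
  apply: leq_trans (rare_color nU); rewrite leq_mul2l; apply/orP; right.
  by apply/subset_leq_card/subsetP => y; rewrite !inE /= E E' cE => /andP[_ /eqP->].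
- have [->|ij] := eqVneq i j; first by exists j => w; apply: le0 => x; rewrite inE.
  exists j => w; apply: (le1 _ (vert (odd j)) (wvert w i)) => // x.
  by rewrite inE /wvert updE updN // => /eqP.
- exists j => w; have [jE|jE] := boolP ((j == i) || (j == ordS i)).
    apply: le0 => x; rewrite inE; apply: chi_out.
    rewrite !inE /wvert -odd_ordS //.
    by case/orP: jE => /eqP->; rewrite eqxx ?orbT.
  case/norP: jE => ji jSi.
  apply: (le1 _ (vert (odd j)) (chi (wedge w i))) => // x.
  by rewrite inE /wvert /wedge updE !updN 1?eq_sym // => /eqP.
Qed.

(** There are [5 * k ^ 2 < D] events, each of probability at most [1 / D], so some walk avoids them
    all. Without bad endpoints, none of its edges is covered. *)
Lemma bipartite_rainbow (K : {set {set V}}) :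
  (forall b a a', bedge b a a' \in K) -> rainbow_cycle id chi K k.
Proof.
move=> inK; have s0 : 0 < s by lia.
have [|w noev] := avoid_rare_events (D := D) s0 _ events_rare.
  by rewrite !card_prod !card_ord mulnC mulnn.
have nbad (i : 'I_k) : ~~ bad (odd i) (w i).
  by have := noev (i, i, @Ordinal 5 0 isT).
have nU (i : 'I_k) : wedge w i \notin U.
  by have := noev (i, i, @Ordinal 5 1 isT); rewrite /= nbad.
have nchi (i j : 'I_k) : i != j -> chi (wedge w i) != chi (wedge w j).
  by move=> ij; have := noev (i, j, @Ordinal 5 2 isT); rewrite /= ij nU.
have nv (i j : 'I_k) : i != j -> wvert w i != wvert w j.
  by move=> ij; have := noev (i, j, @Ordinal 5 3 isT); rewrite /= ij.
have nc (i j : 'I_k) : chi (wedge w i) != wvert w j.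
  exact: (noev (i, j, @Ordinal 5 4 isT)).
have wE (i : 'I_k) : wedge w i = [set wvert w i; wvert w (ordS i)].
  by rewrite /wvert odd_ordS.
exists (wvert w), (wedge w); split=> //.
- by move=> i j /eqP; case: (eqVneq i j) => // /nv/negPf->.
- by move=> i; rewrite inK wE !inE !eqxx orbT.
- by move=> i j x _; rewrite wE !inE.
- by move=> i j x; rewrite (wE j) !inE => /orP[] /eqP->.
Qed.

End Bipartite.

Lemma box2_vert (V : finType) s (K : {set {set V}}) : is_box s 2 K ->
  exists vert : bool -> 'I_s -> V,
    [/\ forall b b' a a', vert b a = vert b' a' -> b = b' /\ a = a',
        forall b a a', [set vert b a; vert (~~ b) a'] \in K
      & forall e, e \in K -> exists a a', e = [set vert false a; vert true a']].
Proof.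
move=> [X [K' [Xs [Y [K'' [Ys -> _ ->]]] XY ->]]].
have inY y : y \in Y -> [set y] \in [set x |: f | x in Y, f in [set set0]].
  by move=> yY; apply/imset2P; exists y set0; rewrite ?inE // setU0.
have nXY x y : x \in X -> y \in Y -> x != y.
  by move=> xX /inY yY; have := XY _ _ xX yY; rewrite inE.
pose vert (b : bool) (a : 'I_s) := if b then enum_val (cast_ord (esym Ys) a)
  else enum_val (cast_ord (esym Xs) a).
have Xv a : vert false a \in X by apply: enum_valP.
have Yv a : vert true a \in Y by apply: enum_valP.
have inK a a' : [set vert false a; vert true a'] \in
    [set x |: f | x in X, f in [set x |: f | x in Y, f in [set set0]]].
  by apply/imset2P; exists (vert false a) [set vert true a']; rewrite ?inY.
exists vert; split.
- move=> [] [] a a' /eqP; rewrite ?(negPf (nXY _ _ (Xv _) (Yv _))) //;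
    try by rewrite eq_sym (negPf (nXY _ _ (Xv _) (Yv _))).
  + by move=> /eqP/enum_val_inj/cast_ord_inj->.
  + by move=> /eqP/enum_val_inj/cast_ord_inj->.
- by move=> [] a a'; rewrite // setUC.
- move=> _ /imset2P[x _ xX /imset2P[y _ yY /set1P-> ->] ->].
  exists (cast_ord Xs (enum_rank_in xX x)), (cast_ord Ys (enum_rank_in yY y)).
  by rewrite /vert !cast_ordK !enum_rankK_in // setU0.
Qed.

(** * Finding boxes *)

Definition nbrs (V : finType) (G : {set {set V}}) (f : {set V}) :=
  [set x | (x \notin f) && (x |: f \in G)].

Lemma edges_le_nbrs (V : finType) (G : {set {set V}}) q :
  (forall e, e \in G -> #|e| = q.+1) ->
  #|G| <= \sum_(f : {set V} | #|f| == q) #|nbrs G f|.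
Proof.
move=> Gq.
pose A := [set p : {set V} * V | (#|p.1| == q) && (p.2 \in nbrs G p.1)].
apply: leq_trans (_ : #|[set p.2 |: p.1 | p in A]| <= _).
  apply/subset_leq_card/subsetP => e eG.
  have /set0Pn[x xe] : e != set0 by rewrite -card_gt0 (Gq _ eG).
  apply/imsetP; exists (e :\ x, x); rewrite ?inE /= ?setD1K ?eqxx // eG !andbT.
  by move: (Gq _ eG); rewrite (cardsD1 x) xe add1n => -[->].
apply: leq_trans (leq_imset_card _ _) _.
rewrite [X in _ <= X]big_mkcond /=.
rewrite (eq_bigr (fun f => \sum_x ((f, x) \in A : nat))).
  rewrite pair_bigA -sum1_card big_mkcond; apply: leq_sum => -[f x] _ /=.
  by case: (_ \in A).
move=> f _; case: (boolP (#|f| == q)) => fq.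
  rewrite -[LHS]sum1_card [LHS]big_mkcond.
  by apply: eq_bigr => x _; rewrite !inE fq /=; case: (_ && _).
by rewrite big1 // => x _; rewrite inE (negPf fq).
Qed.

Lemma card_uniform (V : finType) q : #|[set f : {set V} | #|f| == q]| <= #|V| ^ q.
Proof.
rewrite card_draws; apply: leq_trans (_ : #|V| ^_ q <= _).
  by rewrite -bin_ffact leq_pmulr // ?fact_gt0.
rewrite ffact_prod; apply: leq_trans (_ : \prod_(i < q) #|V| <= _).
  by apply: leq_prod => i _; apply: leq_subr.
by rewrite prod_nat_const card_ord.
Qed.

(** Falling factorials are compared factor by factor: for [i < s], [2 ^ j.+2 * (m - i)] is at least
    [2 * n - n]. *)
Lemma leq_bin_scaled n m s j : s * 2 ^ j.+2 <= n -> n <= m * 2 ^ j.+1 ->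
  'C(n, s) <= 2 ^ (j.+2 * s) * 'C(m, s).
Proof.
move=> sn nm; rewrite -(leq_pmul2r (fact_gt0 s)) -mulnA !bin_ffact !ffact_prod.
rewrite expnM -[s in (_ ^ _) ^ s]card_ord -prod_nat_const -big_split /=.
apply: leq_prod => i _; apply: leq_trans (leq_subr _ _) _.
have := ltn_ord i; have : 2 ^ j.+2 = 2 * 2 ^ j.+1 by rewrite expnS.
move: (2 ^ j.+1) (2 ^ j.+2) sn nm => b a sn nm ab im.
have ia : a * i <= s * a by rewrite mulnC leq_mul2r ltnW ?orbT.
have am : a * m = 2 * (m * b) by rewrite ab; lia.
by rewrite mulnBr; lia.
Qed.

(* One coordinate of the Kovari-Sos-Turan-Erdos argument: some [s] vertices
   have a common link of density at least [2 ^- (j.+2 * s.+1)]. *)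
Lemma common_link (V : finType) (G : {set {set V}}) q j s :
  (forall e, e \in G -> #|e| = q.+1) ->
  #|V| ^ q.+1 <= #|G| * 2 ^ j -> 0 < s -> s * 2 ^ j.+2 <= #|V| ->
  exists X : {set V}, exists G' : {set {set V}},
    [/\ #|X| = s, forall f, f \in G' -> #|f| = q,
        forall x f, x \in X -> f \in G' -> (x \notin f) /\ (x |: f \in G)
      & #|V| ^ q <= #|G'| * 2 ^ (j.+2 * s.+1)].
Proof.
move=> Gq dens s0 sn; set n := #|V| in dens sn *.
have n0 : 0 < n by apply: leq_trans sn; rewrite muln_gt0 s0 expn_gt0.
(* [F] keeps the [q]-sets whose degree is at least half of what the density suggests; by averaging
   they have density at least [2 ^- j.+1]. *)
pose F := [set f : {set V} | (#|f| == q) && (n <= #|nbrs G f| * 2 ^ j.+1)].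
have Fbig : n ^ q <= #|F| * 2 ^ j.+1.
  have le : #|G| * 2 ^ j.+1 <= #|F| * (n * 2 ^ j.+1) + n ^ q * n.
    apply: leq_trans (leq_mul (edges_le_nbrs Gq) (leqnn _)) _.
    rewrite big_distrl /=.
    apply: leq_trans (_ : \sum_(f : {set V} | #|f| == q)
      ((if f \in F then n * 2 ^ j.+1 else 0) + n) <= _).
      apply: leq_sum => f fq; rewrite inE fq /=; case: (leqP n (_ * _)) => [_|/ltnW //].
      by rewrite (leq_trans _ (leq_addr _ _)) // leq_mul2r max_card orbT.
    rewrite big_split /=; apply: leq_add.
      rewrite -(sum_nat_const (mem F)) [X in _ <= X]big_mkcond [X in X <= _]big_mkcond /=.
      by apply: leq_sum => f _; case: ifP.
    rewrite sum_nat_const leq_mul2r; apply/orP; right.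
    by apply: leq_trans (card_uniform V q); rewrite cardsE.
  rewrite -(leq_pmul2r n0); move: le dens; rewrite !expnS.
  move: (n ^ q) (2 ^ j) => a b; nia.
pose L (X : {set V}) := [set f in F | X \subset nbrs G f].
(* Each [f] in [F] lies in [L X] for a proportion at least [2 ^- (j.+2 * s)] of the [s]-sets [X], so
   some [X] attains this average. *)
have [X Xs LX] : exists2 X : {set V}, #|X| = s & #|F| <= #|L X| * 2 ^ (j.+2 * s).
  have [/exists_inP[X]|no] := boolP [exists X : {set V} in [set X : {set V} | #|X| == s],
      #|F| <= #|L X| * 2 ^ (j.+2 * s)].
    by rewrite inE => /eqP; exists X.
  set P := 2 ^ (j.+2 * s) in no *.
  pose S := [set X : {set V} | #|X| == s].
  have cS : #|S| = 'C(n, s) by rewrite card_draws.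
  have S0 : 0 < #|S|.
    rewrite cS bin_gt0; apply: leq_trans sn.
    by rewrite leq_pmulr ?expn_gt0.
  have up : \sum_(X in S) (#|L X| * P).+1 <= #|S| * #|F|.
    rewrite -(sum_nat_const (mem S)); apply: leq_sum => X XS.
    by move/exists_inPn: no => /(_ X XS); rewrite -ltnNge.
  have low : #|F| * #|S| <= \sum_(X in S) #|L X| * P.
    apply: leq_trans (_ : \sum_(f in F) P * 'C(#|nbrs G f|, s) <= _).
      rewrite -(sum_nat_const (mem F)) cS; apply: leq_sum => f.
      by rewrite inE => /andP[_]; apply: leq_bin_scaled.
    rewrite -big_distrl -big_distrr /= mulnC leq_mul2r; apply/orP; right.
    rewrite (eq_bigr (fun f => \sum_(X in S) (X \subset nbrs G f : nat))).
      rewrite exchange_big; apply: leq_sum => X _.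
      rewrite -sum1_card big_mkcond [X in _ <= X]big_mkcond.
      apply: leq_sum => f _; rewrite [f \in L X]inE.
      by case: (f \in F) => //=; case: (_ \subset _).
    move=> f _; rewrite -cards_draws -sum1_card big_mkcond [RHS]big_mkcond.
    apply: eq_bigr => X _; rewrite !inE.
    by case: (_ \subset _) => /=; case: (_ == _).
  move: up; rewrite (eq_bigr (fun X => #|L X| * P + 1)); last first.
    by move=> X _; rewrite addn1.
  rewrite big_split /= (sum1_card (mem S)) mulnC leqNgt.
  by rewrite (leq_ltn_trans low) // -addn1 leq_add2l.
exists X, (L X); split=> //.
- by move=> f; rewrite !inE => /andP[/andP[/eqP]].
- move=> x f xX; rewrite inE => /andP[_ /subsetP/(_ x xX)].
  by rewrite inE => /andP[].
- apply: leq_trans Fbig _; apply: leq_trans (leq_mul LX (leqnn _)) _.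
  rewrite -mulnA -expnD leq_mul2l; apply/orP; right; rewrite leq_exp2l //; nia.
Qed.

(** [common_link] is iterated, each round replacing [j] by [j.+2 * s.+1]. Since
    [j.+2 * s.+1 + 2 <= 3 * s * j.+2], one factor [3 * s] in the exponent pays for one round. *)
Lemma box_exists (V : finType) q s j (G : {set {set V}}) :
  (forall e, e \in G -> #|e| = q.+1) -> 0 < s ->
  #|V| ^ q.+1 <= #|G| * 2 ^ j -> s * 2 ^ (j.+2 * (3 * s) ^ q) <= #|V| ->
  exists2 K, is_box s q.+1 K & K \subset G.
Proof.
elim: q j G => [|q IHq] j G Gq s0 dens sn.
  have [|X [G' [Xs G'0 XG' dens']]] := common_link Gq dens s0.
    by rewrite expn0 muln1 in sn.
  have /set0Pn[f fG'] : G' != set0.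
    by rewrite -card_gt0; case: #|G'| dens'; rewrite // expn0 mul0n.
  have f0 : f = set0 by apply/eqP; rewrite -cards_eq0 (G'0 _ fG').
  exists [set x |: f | x in X, f in [set set0]].
    exists X, [set set0]; split=> //.
    by move=> x g _ /set1P->; rewrite inE.
  apply/subsetP => _ /imset2P[x g xX /set1P-> ->].
  by have [] := XG' x f xX fG'; rewrite f0.
have s3 : 0 < (3 * s) ^ q.+1 by rewrite expn_gt0 muln_gt0 s0.
have [|X [G' [Xs G'q XG' dens']]] := common_link Gq dens s0.
  by apply: leq_trans sn; rewrite leq_mul2l leq_exp2l // leq_pmulr ?orbT.
have [|K' boxK' K'G'] := IHq _ _ G'q s0 dens'.
  apply: leq_trans sn; rewrite leq_mul2l leq_exp2l //; apply/orP; right.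
  rewrite [X in _ <= _ * X]expnS mulnA leq_mul2r; apply/orP; right; nia.
exists [set x |: f | x in X, f in K'].
  exists X, K'; split=> // x f xX /(subsetP K'G')fG'.
  by have [] := XG' x f xX fG'.
apply/subsetP => _ /imset2P[x f xX /(subsetP K'G')fG' ->].
by have [] := XG' x f xX fG'.
Qed.

(** * Good colourings *)

Lemma subset_delete (V : finType) (e f : {set V}) :
  f \subset e -> #|e| = #|f|.+1 -> exists2 x, x \in e & e :\ x = f.
Proof.
move=> fe ef; have /eqP/cards1P[x xE] : #|e :\: f| = 1.
  by rewrite cardsD (setIidPr fe) ef subSnn.
have /setDP[xe xf] : x \in e :\: f by rewrite xE set11.
exists x => //; apply/eqP; rewrite eq_sym eqEcard subsetD1 fe xf /=.
by move: ef; rewrite (cardsD1 x) xe add1n => -[->].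
Qed.

(** The edges through [f0 = e0 :\ x0] are removed and their colours become the list of [f0]. No
    remaining edge contains [f0], so overwriting its list harms none of them. *)
Lemma elimination (V Z : finType) (chi : {set V} -> Z) (K : {set {set V}}) q D :
  (forall e, e \in K -> #|e| = q.+1) ->
  (forall K' : {set {set V}}, K' \subset K -> K' != set0 ->
     exists e, exists x, [/\ e \in K', x \in e & #|colors chi K' (e :\ x)| <= D]) ->
  exists lam : {set V} -> {set Z}, (forall f, #|lam f| <= D) /\
    forall e, e \in K -> exists2 x, x \in e & chi e \in lam (e :\ x).
Proof.
move: {2}_.+1 (ltnSn #|K|) => m; elim: m K => // m IHm K Km Kq dgn.
have [->|K0] := eqVneq K set0.
  by exists (fun=> set0); split=> [f|e]; rewrite ?cards0 ?inE.
have [e0 [x0 [e0K x0e cD]]] := dgn K (subxx _) K0.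
pose f0 := e0 :\ x0; pose K1 := [set e in K | ~~ (f0 \subset e)].
have sK1 : K1 \subset K by apply/subsetP => e /[!inE] /andP[].
have [|||lam1 [lamD lam1P]] := IHm K1.
- rewrite ltnS in Km; apply: leq_trans Km; apply/proper_card/properP; split=> //.
  by exists e0; rewrite // inE e0K subD1set.
- by move=> e /(subsetP sK1)/Kq.
- by move=> K' /subset_trans/(_ sK1); apply: dgn.
exists (fun f => if f == f0 then colors chi K f0 else lam1 f); split.
  by move=> f; case: ifP.
move=> e eK; have [fe|fe] := boolP (f0 \subset e).
  have [|x xe xE] := subset_delete fe.
    by rewrite (Kq _ eK) -(Kq _ e0K) (cardsD1 x0 e0) x0e.
  by exists x => //; rewrite xE eqxx imset_f // inE eK.
have [|x xe cx] := lam1P e; first by rewrite inE eK.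
exists x => //; case: eqP => // eqf; move: fe; rewrite -eqf.
by rewrite subD1set.
Qed.

Section Colorings.
Variable V : finType.
Implicit Types (chi : {ffun {set V} -> option V}) (G K U : {set {set V}}).

Definition ext chi : {set {set V}} :=
  [set e | [exists f : {set V}, exists z, (chi f == Some z) && (e == z |: f)]].

Definition supp chi : {set {set V}} := [set f | chi f != None].

Definition goodcol q k : {set {ffun {set V} -> option V}} :=
  [set chi : {ffun {set V} -> option V} | [forall f : {set V}, forall z,
                (chi f == Some z) ==> (#|f| == q) && (z \notin f)]
     && ~~ [exists C : {set {set V}}, (C \subset ext chi) && loose_cycle q.+1 k C]].

Lemma goodcolP q k chi f z : chi \in goodcol q k -> chi f = Some z ->
  #|f| = q /\ z \notin f.
Proof.
rewrite inE => /andP[/forallP/(_ f)/forallP/(_ z)/implyP H _] cf.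
by move: H; rewrite cf => /(_ (eqxx _)) /andP[/eqP-> ->].
Qed.

Lemma supp_color K chi (x0 : V) e : K \subset supp chi -> e \in K ->
  chi e = Some (odflt x0 (chi e)).
Proof. by move=> /subsetP/(_ e)/[apply]; rewrite inE; case: (chi e). Qed.

(** Adding its colour to each edge of a strongly rainbow cycle creates no new intersection, so a
    loose cycle appears in [ext chi]. The default [x0] is never taken on the support. *)
Lemma good_no_rainbow q k chi K x0 : 2 < k -> chi \in goodcol q k ->
  K \subset supp chi -> ~ rainbow_cycle id (fun e => odflt x0 (chi e)) K k.
Proof.
move=> k2 chiG Ks [w [e [wI eK ee ec ex]]].
pose c f := odflt x0 (chi f).
have cE i : chi (e i) = Some (c (e i)).
  by apply: (supp_color x0 Ks); have [] := eK i.
move: (chiG); rewrite inE => /andP[_ /existsPn/(_ [set c (e i) |: e i | i : 'I_k])].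
case/negP; apply/andP; split.
  apply/subsetP => _ /imsetP[i _ ->]; rewrite inE.
  by apply/existsP; exists (e i); apply/existsP; exists (c (e i)); rewrite cE !eqxx.
apply: (loose_cycle_core k2 wI).
- by move=> i; have [eq zn] := goodcolP chiG (cE i); rewrite cardsU1 zn eq.
- by move=> i; have [_ we _] := eK i; rewrite inE we orbT.
- by move=> i; have [_ _ we] := eK i; rewrite inE we orbT.
move=> i j x ij; rewrite !inE => /predU1P[->|xi] /predU1P[xj|xj].
- by move: (ec i j ij); rewrite /c in xj; rewrite xj eqxx.
- by move: (ex i j _ xj); rewrite eqxx.
- by move: (ex j i _ xi); rewrite xj eqxx.
- exact: ee xi xj.
Qed.

End Colorings.

(** Given the lists, the colour of an edge of [U] is encoded by a vertex to delete and a position on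
    a list. *)
Definition list_covered (V : finType) D (chi : {ffun {set V} -> option V})
    (U : {set {set V}}) :=
  exists lam : {set V} -> {set V}, (forall f, #|lam f| <= D) /\
    forall e, e \in U -> exists x z, [/\ x \in e, z \in lam (e :\ x) & chi e = Some z].

(** The interface between finding cycles and counting: in every box a proportion [1 / E] of the
    edges is cheap to colour. *)
Definition box_coverable q k D E :=
  forall (V : finType) s (K : {set {set V}}) (chi : {ffun {set V} -> option V}),
    0 < s -> is_box s q K -> chi \in goodcol V q k -> K \subset supp chi ->
    exists U : {set {set V}}, [/\ U \subset K, s ^ q <= E * #|U| & list_covered D chi U].

(** The whole box is covered: where [elimination] cannot proceed, the greedy argument yields a
    rainbow cycle. *)
Lemma box_coverable_ge3 q k : 2 < q -> 2 < k ->
  box_coverable q k (2 * (k * q.+2)) 1.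
Proof.
move=> q2 k2 V s K chi s0 boxK chiG Ks.
exists K; rewrite (card_box boxK) mul1n; split=> //.
have [x0] : exists x0 : V, true.
  have : 0 < #|K| by rewrite (card_box boxK) expn_gt0 s0.
  rewrite card_gt0 => /set0Pn[e eK].
  have : 0 < #|e| by rewrite (box_uniform boxK eK) ltnW // ltnW.
  by rewrite card_gt0 => /set0Pn[x _]; exists x.
move=> _; pose c f := odflt x0 (chi f).
have [e eK|K' K'K K'0|lam [lamD lamP]] :=
    @elimination V V c K q.-1 (2 * (k * q.+2)).
- by rewrite (box_uniform boxK eK) prednK // ltnW // ltnW.
- have K's := subset_trans K'K Ks.
  have [/exists_inP[e eK' /exists_inP[x xe le]]|no] :=
    boolP [exists e : {set V} in K', exists x in e,
      #|colors c K' (e :\ x)| <= 2 * (k * q.+2)]; first by exists e, x.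
  case: (good_no_rainbow (x0 := x0) k2 chiG K's).
  apply: (full_rainbow_cycle (q := q) (D := 2 * (k * q.+2))) => //.
  + by move=> e /(subsetP K'K)/(box_uniform boxK).
  + move=> e x eK' xe; have [_] := goodcolP chiG (supp_color x0 K's eK').
    by apply: contraNneq => ->.
  + move=> e x eK' xe; rewrite ltnNge; apply: contraNN no => le.
    by apply/exists_inP; exists e => //; apply/exists_inP; exists x.
- exists lam; split=> // e eK; have [x xe cx] := lamP e eK.
  by exists x, (c e); rewrite (supp_color x0 Ks eK).
Qed.

(** [U] consists of the edges whose colour is frequent at one of their ends. Were it small, a random
    closed walk would give a rainbow cycle. *)
Lemma box_coverable_2 k : ~~ odd k -> 2 < k ->
  box_coverable 2 k (5 * k ^ 2).+1 ((5 * k ^ 2).+1 ^ 2).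
Proof.
set D := (5 * k ^ 2).+1.
move=> kE k2 V s K chi s0 boxK chiG Ks.
have [vert [vertI inK Kvert]] := box2_vert boxK.
pose x0 := vert true (Ordinal s0); pose c f := odflt x0 (chi f).
have cE e : e \in K -> chi e = Some (c e) := supp_color x0 Ks.
(* [H b a] lists the colours on more than [s / D] of the edges at a vertex. *)
pose H b a := [set z | s < D * #|[set a' | c (bedge vert b a a') == z]|].
pose lam (f : {set V}) :=
  if [pick p : bool * 'I_s | f == [set vert p.1 p.2]] is Some p
  then H p.1 p.2 else set0.
have lamE b a : lam [set vert b a] = H b a.
  rewrite /lam; case: pickP => [[b' a'] /= /eqP/set1_inj/vertI[-> ->] //|].
  by move/(_ (b, a)); rewrite eqxx.
have HD b a : #|H b a| <= D.
  rewrite -(leq_pmul2r s0); apply: leq_trans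
    (_ : \sum_(z in H b a) D * #|[set a' | c (bedge vert b a a') == z]| <= _).
    by rewrite -(sum_nat_const (mem (H b a))); apply: leq_sum => z /[!inE] /ltnW.
  rewrite -big_distrr leq_mul2l /=.
  apply: leq_trans (_ : \sum_z \sum_(a' < s) (c (bedge vert b a a') == z : nat) <= _).
    rewrite big_mkcond; apply: leq_sum => z _; case: ifP => // _.
    rewrite -sum1_card big_mkcond; apply: leq_sum => a' _.
    by rewrite inE; case: eqP.
  rewrite exchange_big -[X in _ <= X]card_ord -[X in _ <= X]sum1_card.
  apply: leq_sum => a' _; rewrite (bigD1 (c (bedge vert b a a'))) //= eqxx.
  by rewrite big1 // => z; rewrite eq_sym => /negPf->.
pose U := [set e in K | [exists b, exists a, exists a',
  (e == bedge vert b a a') && (c e \in H b a)]].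
have UK : U \subset K by apply/subsetP => e /[!inE] /andP[].
have inU b a a' : c (bedge vert b a a') \in H b a -> bedge vert b a a' \in U.
  move=> cH; rewrite inE inK; apply/existsP; exists b; apply/existsP; exists a.
  by apply/existsP; exists a'; rewrite eqxx.
exists U; split=> //.
  (* For [s < D] a single edge already makes its colour frequent, so [U] is all of [K]. *)
  have [sD|Ds] := ltnP s D.
    rewrite -(card_box boxK) -[X in X <= _]mul1n leq_mul //.
    apply/subset_leq_card/subsetP => e /Kvert[a [a' ->]].
    rewrite (inU false) // inE (leq_trans sD) // leq_pmulr // card_gt0.
    by apply/set0Pn; exists a'; rewrite inE.
  rewrite leqNgt; apply/negP => Usmall.
  apply: (good_no_rainbow (x0 := x0) k2 chiG Ks).
  apply: (bipartite_rainbow (D := D) (U := U) vertI) => //.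
  - move=> b a a' x xe; have [_] := goodcolP chiG (cE _ (inK b a a')).
    by apply: contraNneq => eq; rewrite /c eq.
  - exact: ltnW.
  - by move=> b a a'; apply: contraNT; rewrite -ltnNge => lt; apply: inU; rewrite inE.
exists lam; split.
  by move=> f; rewrite /lam; case: pickP => [[b a] _|_]; rewrite ?HD ?cards0.
move=> e eU; have eK := subsetP UK _ eU.
move: eU; rewrite inE => /andP[_ /existsP[b /existsP[a /existsP[a' /andP[/eqP eE cH]]]]].
exists (vert (~~ b) a'), (c e); split; last exact: cE.
- by rewrite eE !inE eqxx orbT.
- rewrite (_ : _ :\ _ = [set vert b a]) ?lamE // eE.
  apply/setP => x; rewrite !inE; case: eqP => //= [->|_]; last by rewrite orbF.
  by apply/esym/eqP => /vertI[]; case: (b).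
Qed.

(** * Counting the colourings over one box *)

Section CountStep.
Variables (V : finType) (q k D : nat).
Implicit Types (chi : {ffun {set V} -> option V}) (G K U : {set {set V}}).

Definition good_on G : {set {ffun {set V} -> option V}} :=
  [set chi in goodcol V q k | supp chi == G].

Lemma good_on_restrict G U chi : chi \in good_on G ->
  [ffun e => if e \in U then None else chi e] \in good_on (G :\: U).
Proof.
rewrite !inE => /andP[/andP[/forallP val noC] /eqP<-].
apply/andP; split; last by apply/eqP/setP => e; rewrite !inE ffunE; case: (e \in U).
apply/andP; split.
  apply/forallP => f; rewrite ffunE; case: (f \in U); last exact: val.
  by apply/forallP => z; rewrite eqE.
apply: contraNN noC => /existsP[C /andP[Cs cyc]]; apply/existsP; exists C.
rewrite cyc andbT; apply: subset_trans Cs _; apply/subsetP => e.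
rewrite !inE => /existsP[f /existsP[z /andP[]]]; rewrite ffunE.
case: (f \in U) => [|cf ez]; first by rewrite eqE.
by apply/existsP; exists f; apply/existsP; exists z; rewrite cf.
Qed.

(** A colouring is recovered by [dec] from its lists on the shadow, a pair of indices for each edge
    of [U], and its restriction off [U]. *)
Lemma count_covered G K U : 0 < #|V| -> 0 < q -> 0 < D ->
  U \subset K -> K \subset G ->
  forall A : {set {ffun {set V} -> option V}}, A \subset good_on G ->
    (forall chi, chi \in A -> list_covered D chi U) ->
  #|A| <= (#|V| ^ D) ^ #|shadow K| * (q * D) ^ #|U| * #|good_on (G :\: U)|.
Proof.
move=> V0 q0 D0 UK KG A AG cov.
have /card_gt0P[x0 _] := V0.
pose i0 : 'I_q * 'I_D := (Ordinal q0, Ordinal D0).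
pose y0 : {ffun 'I_D -> V} := [ffun=> x0].
(* Lists are padded to length [D] and both kinds of data are constant off their domain, so they are
   counted by powers. *)
pose Lam := [set l : {ffun {set V} -> {ffun 'I_D -> V}} |
  l \in pffun_on y0 (mem (shadow K)) predT].
pose Idx := [set h : {ffun {set V} -> 'I_q * 'I_D} | h \in pffun_on i0 (mem U) predT].
pose dec (p : {ffun {set V} -> {ffun 'I_D -> V}} * {ffun {set V} -> 'I_q * 'I_D}
     * {ffun {set V} -> option V}) : {ffun {set V} -> option V} :=
  [ffun e => if e \in U
     then Some (p.1.1 (e :\ nth x0 (enum e) (p.1.2 e).1) (p.1.2 e).2) else p.2 e].
have cLam : #|Lam| = (#|V| ^ D) ^ #|shadow K|.
  by rewrite cardsE card_pffun_on card_ffun card_ord.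
have cIdx : #|Idx| = (q * D) ^ #|U|.
  by rewrite cardsE card_pffun_on card_prod !card_ord.
rewrite -cLam -cIdx -!cardsX.
apply: leq_trans (leq_imset_card dec _); apply/subset_leq_card/subsetP => chi chiA.
have chiG := subsetP AG _ chiA.
have [lam [lamD lamP]] := cov _ chiA.
pose l := [ffun f : {set V} => if f \in shadow K then
  [ffun j : 'I_D => nth x0 (enum (lam f)) j] else y0].
pose h := [ffun e : {set V} => if e \in U then
  if [pick p : V * V | [&& p.1 \in e, p.2 \in lam (e :\ p.1) & chi e == Some p.2]]
    is Some p then
    (insubd i0.1 (index p.1 (enum e)), insubd i0.2 (index p.2 (enum (lam (e :\ p.1)))))
  else i0 else i0].
apply/imsetP; exists (l, h, [ffun e => if e \in U then None else chi e]).
  rewrite !in_setX good_on_restrict // andbT !inE; apply/andP; split.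
    apply/pffun_onP; split=> //.
    by apply/supportP => f fn; rewrite ffunE (negPf fn).
  apply/pffun_onP; split=> //.
  by apply/supportP => f fn; rewrite ffunE (negPf fn).
apply/ffunP => e; rewrite !ffunE /=; case: (boolP (e \in U)) => // eU.
case: pickP => [[x z] /= /and3P[xe zl /eqP cE]|no]; last first.
  by have [x [z [xe zl cE]]] := lamP e eU; have := no (x, z); rewrite /= xe zl cE eqxx.
have eq : #|e| = q by move: chiG; rewrite inE => /andP[/goodcolP/(_ cE)[]].
have ix : index x (enum e) < q by rewrite -eq cardE index_mem mem_enum.
have iz : index z (enum (lam (e :\ x))) < D.
  by apply: leq_trans (lamD (e :\ x)); rewrite cardE index_mem mem_enum.
rewrite !val_insubd ix nth_index ?mem_enum //.
have -> : e :\ x \in shadow K.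
  by apply/bigcupP; exists e; [exact: (subsetP UK) | exact: imset_f].
by rewrite ffunE val_insubd iz nth_index ?mem_enum.
Qed.

(** The covered set varies with the colouring, but it is one of [2 ^ (s ^ q)] subsets of [K]. Taking
    for [U] the admissible subset that leaves the most colourings bounds all of these cases at
    once. *)
Lemma count_step E G K s : 0 < #|V| -> 0 < q -> 0 < D -> 0 < E -> 0 < s ->
  box_coverable q k D E -> is_box s q K -> K \subset G ->
  exists U, [/\ U \subset K, s ^ q <= E * #|U| &
    #|good_on G| <= 2 ^ (s ^ q) * ((#|V| ^ D) ^ (q * s ^ q.-1) * (q * D) ^ (s ^ q))
      * #|good_on (G :\: U)|].
Proof.
move=> V0 q0 D0 E0 s0 cov boxK KG.
pose ok U := (U \subset K) && (s ^ q <= E * #|U|).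
have okK : ok K by rewrite /ok subxx (card_box boxK) leq_pmull.
pose N U := #|good_on (G :\: U)|.
have [U /andP[UK Ubig] Umax] := arg_maxnP (P := ok) N okK.
exists U; split=> //; rewrite -/(N U).
set M := (_ ^ D) ^ _ * _.
pose A U' := [set chi in good_on G | `[< list_covered D chi U' >]].
have cA U' : ok U' -> #|A U'| <= M * N U.
  move=> okU'; have /andP[U'K U'big] := okU'.
  apply: leq_trans (count_covered V0 q0 D0 U'K KG (A := A U') _ _) _.
  - by apply/subsetP => chi; rewrite inE => /andP[].
  - by move=> chi; rewrite inE => /andP[_ /asboolP].
  apply: leq_mul (Umax _ okU'); apply: leq_mul.
    by rewrite leq_pexp2l ?expn_gt0 ?V0 // card_shadow_box.
  by rewrite leq_pexp2l ?muln_gt0 ?q0 // -(card_box boxK) subset_leq_card.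
apply: leq_trans (_ : #|\bigcup_(U' in powerset K | ok U') A U'| <= _).
  apply/subset_leq_card/subsetP => chi chiG.
  have chig : chi \in goodcol V q k by move: chiG; rewrite inE => /andP[].
  have Ks : K \subset supp chi by move: chiG; rewrite inE => /andP[_ /eqP->].
  have [U' [U'K U'big U'cov]] := cov V s K chi s0 boxK chig Ks.
  apply/bigcupP; exists U'; first by rewrite powersetE U'K /ok U'K U'big.
  by rewrite inE chiG; apply/asboolP.
apply: leq_trans (_ : \sum_(U' in powerset K | ok U') #|A U'| <= _).
  elim/big_rec2: _ => [|i y S _ le]; first by rewrite cards0.
  by apply: leq_trans (leq_card_setU _ _) _; rewrite leq_add2l.
apply: leq_trans (_ : \sum_(U' in powerset K) M * N U <= _).
  rewrite big_mkcondr; apply: leq_sum => U' _; case: ifP => // okU'.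
  exact: cA.
by rewrite sum_nat_const card_powerset (card_box boxK) mulnA.
Qed.
End CountStep.

(** * Counting good colourings *)

(* [lvl N i] is the least [j] with [N <= i * 2 ^ j], written as a count so that
   it can be summed over [i]. *)
Definition lvl N i := \sum_(j < N) (i * 2 ^ j < N : nat).

Lemma lvlP N i : 0 < i -> N <= i * 2 ^ lvl N i.
Proof.
move=> i0; rewrite leqNgt; apply/negP; set t := lvl N i => lt.
have tN : t < N.
  apply: leq_ltn_trans lt; apply: leq_trans (leq_pmull _ i0).
  exact/ltnW/ltn_expl.
suff : t < lvl N i by rewrite ltnn.
rewrite -[t.+1]muln1 -[t.+1]card_ord -sum_nat_const.
rewrite (big_ord_widen N (fun=> 1)) // big_mkcond; apply: leq_sum => j _.
case: ifP => //; rewrite ltnS => jt.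
rewrite (leq_ltn_trans _ lt) // leq_mul2l leq_exp2l // jt orbT //.
Qed.

Lemma lvl_anti N i i' : i <= i' -> lvl N i' <= lvl N i.
Proof.
move=> le; apply: leq_sum => j _; case: (ltnP (i' * _)) => // lt.
by rewrite (leq_ltn_trans _ lt) // leq_mul2r le orbT.
Qed.

(** After exchanging the sums, [j] contributes at most [N %/ 2 ^ j] indices, a geometric series. *)
Lemma sum_lvl N : \sum_(1 <= i < N.+1) lvl N i <= 2 * N.
Proof.
rewrite exchange_big /=; apply: leq_trans (_ : \sum_(j < N) N %/ 2 ^ j <= _).
  apply: leq_sum => j _; have := expn_gt0 2 j; move: (2 ^ j) => a; rewrite orTb => a0.
  apply: leq_trans (_ : \sum_(1 <= i < N.+1) (i <= N %/ a : nat) <= _).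
    rewrite leq_sum // => i _; case: (ltnP (i * a)) => // lt.
    by rewrite leq_divRL // (ltnW lt).
  have cnt m b : \sum_(1 <= i < m.+1) (i <= b : nat) <= minn m b.
    elim: m => [|m IHm]; first by rewrite big_geq.
    by rewrite big_nat_recr //=; case: leqP; lia.
  by apply: leq_trans (cnt _ _) (geq_minr _ _).
have tele J : \sum_(j < J) N %/ 2 ^ j + 2 * (N %/ 2 ^ J) <= 2 * N.
  elim: J => [|J IHJ]; first by rewrite big_ord0 divn1.
  rewrite big_ord_recr /= expnSr divnMA.
  have := leq_divM (N %/ 2 ^ J) 2; move: IHJ (_ %/ 2); move: (N %/ _) (\sum_(_ < _) _).
  by move=> a S IHJ b; lia.
by apply: leq_trans (tele N); apply: leq_addr.
Qed.

(** * Summing the cost over the removed boxes *)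

Section GoodColorings.
Variables (V : finType) (q k D E B L T Q : nat).
Hypotheses (D0 : 0 < D) (E0 : 0 < E) (q1 : 1 < q).
Hypothesis cov : box_coverable q k D E.
Hypothesis qDB : q * D <= 2 ^ B.
Hypothesis Ln : 2 ^ L <= #|V|.
Hypothesis nL : #|V| <= 2 ^ L.+1.
Hypotheses (T0 : 0 < T) (TL : T ^ q.-1 <= L) (LQT : L.+1 <= Q * T).
Implicit Types G K U : {set {set V}}.

(** Bits per removed edge at density [2 ^- j]: 1 for the choice of [U], [B] for the indices, and the
    rest for [q * s ^ q.-1] lists of [D] vertices of [L.+1] bits, shared by [s ^ q] edges; [E]
    passes from the box to [U]. *)
Definition weight j := E * (1 + B + 12 * D * q * Q * (j + 3)).

Lemma large_box G j : G != set0 -> (forall e, e \in G -> #|e| = q) ->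
  #|V| ^ q <= #|G| * 2 ^ j ->
  exists K s, [/\ 0 < s, T <= 12 * (j + 3) * s, is_box s q K & K \subset G].
Proof.
(* With this [s], the exponent [A] of [box_exists] satisfies [2 * A <= T ^ q.-1 <= L], so
   [s * 2 ^ A <= 2 ^ L]. *)
move=> /set0Pn[e eG] Gq dens; pose s := T %/ (6 * (j + 3)).
have d0 : 0 < 6 * (j + 3) by rewrite muln_gt0 addnS.
have Tlt : T < s.+1 * (6 * (j + 3)) by rewrite ltn_ceil.
have [s0|s0] := posnP s.
  (* Here [T < 6 * (j + 3)], and a single edge serves as a box of side 1. *)
  exists [set e], 1; split=> //; last by rewrite sub1set.
    by move: Tlt; rewrite s0; lia.
  exact: box_set1 (Gq _ eG).
have qE : q = q.-2.+2 by move: q1; case: (q) => [|[]].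
have [||||K boxK KG] := @box_exists V q.-1 s j G.
- by move=> e' /Gq->; rewrite prednK // ltnW.
- exact: s0.
- by rewrite prednK // ltnW.
- have sT : 2 * (j + 3) * (3 * s) <= T.
    by have := leq_divM T (6 * (j + 3)); rewrite -/s; lia.
  set A := j.+2 * (3 * s) ^ q.-1.
  have A2L : 2 * A <= L.
    apply: leq_trans TL; apply: leq_trans (_ : (2 * (j + 3) * (3 * s)) ^ q.-1 <= _).
      rewrite /A (expnMn (2 * (j + 3))) mulnA leq_mul2r; apply/orP; right.
      apply: leq_trans (_ : 2 * (j + 3) <= _); first lia.
      by rewrite qE /= expnS leq_pmulr // expn_gt0 muln_gt0 addnS.
    by rewrite leq_exp2r // qE.
  have sA : s <= A.
    apply: leq_trans (leq_pmull _ _) => //; rewrite qE /= expnS.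
    apply: leq_trans (_ : 3 * s <= _); first lia.
    by rewrite leq_pmulr // expn_gt0 muln_gt0 s0.
  apply: leq_trans Ln; apply: leq_trans (_ : 2 ^ A * 2 ^ A <= _).
    rewrite leq_mul2r; apply/orP; right.
    by apply: leq_trans sA (ltnW (ltn_expl _ _)).
  by rewrite -expnD addnn -mul2n leq_exp2l.
exists K, s; split=> //; last by rewrite prednK ?(ltnW q1) // in boxK.
by move: Tlt; rewrite mulSn; move: s0 {boxK}; move: (s) => x; nia.
Qed.

Lemma count_extract G j : G != set0 -> (forall e, e \in G -> #|e| = q) ->
  #|V| ^ q <= #|G| * 2 ^ j ->
  exists U, [/\ U \subset G, 0 < #|U| &
    #|good_on q k G| <= 2 ^ (#|U| * weight j) * #|good_on q k (G :\: U)|].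
Proof.
move=> G0 Gq dens; have [K [s [s0 Ts boxK KG]]] := large_box G0 Gq dens.
have V0 : 0 < #|V| by apply: leq_trans Ln; rewrite expn_gt0.
have [U [UK Ubig le]] := count_step V0 (ltnW q1) D0 E0 s0 cov boxK KG.
exists U; split; first exact: subset_trans UK KG.
  by rewrite lt0n; apply: contraTneq Ubig => ->; rewrite muln0 -ltnNge expn_gt0 s0.
apply: leq_trans le _; rewrite leq_mul2r; apply/orP; right.
apply: leq_trans (_ : 2 ^ (s ^ q) * (2 ^ (L.+1 * D * (q * s ^ q.-1)) * 2 ^ (B * s ^ q)) <= _).
  rewrite leq_mul2l; apply/orP; right; apply: leq_mul.
    rewrite [X in _ <= X]expnM leq_exp2r ?muln_gt0 ?(ltnW q1) ?expn_gt0 ?s0 //.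
    by rewrite expnM leq_exp2r.
  by rewrite [X in _ <= X]expnM leq_exp2r ?expn_gt0 ?s0.
rewrite -!expnD leq_exp2l //.
apply: leq_trans (_ : s ^ q * (1 + B + 12 * D * q * Q * (j + 3)) <= _); last first.
  by rewrite /weight mulnA (mulnC #|U|) leq_mul2r Ubig orbT.
have sq : s ^ q = s * s ^ q.-1 by rewrite -expnS prednK // ltnW.
rewrite !mulnDr muln1 -addnA leq_add2l addnC (mulnC B) leq_add2l.
rewrite sq; move: (s ^ q.-1) => a.
apply: leq_trans (_ : Q * (12 * (j + 3) * s) * D * (q * a) <= _); last by nia.
by rewrite !leq_mul2r (leq_trans LQT) ?orbT // leq_mul2l Ts orbT.
Qed.

(** Removing [U] costs [#|U|] times the weight at [#|G|]. As levels only grow when [i] falls, this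
    is at most the sum of the weights for [i] from [#|G :\: U|.+1] to [#|G|]. *)
Lemma good_on_bound G :
  #|good_on q k G| <= 2 ^ (\sum_(1 <= i < #|G|.+1) weight (lvl (#|V| ^ q) i)).
Proof.
move: {2}_.+1 (ltnSn #|G|) => m; elim: m G => // m IHm G; rewrite ltnS => Gm.
have [->|G0] := eqVneq G set0.
  apply: leq_trans (_ : 1 <= _); last by rewrite expn_gt0.
  apply/card_le1_eqP => c d; rewrite !inE => /andP[_ /eqP c0] /andP[_ /eqP d0].
  apply/ffunP => e; move/setP/(_ e): c0; move/setP/(_ e): d0; rewrite !inE.
  by move=> /negbFE/eqP-> /negbFE/eqP->.
have [->|[chi chiG]] := set_0Vmem (good_on q k G); first by rewrite cards0.
have Gq e : e \in G -> #|e| = q.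
  move: chiG; rewrite inE => /andP[cg /eqP<-]; rewrite inE.
  by case ce: (chi e) => [z|//] _; have [] := goodcolP cg ce.
have c0 : 0 < #|G| by rewrite card_gt0.
have [U [UG U0 le]] := count_extract G0 Gq (lvlP _ c0).
have cU : #|G :\: U| + #|U| = #|G|.
  by rewrite cardsD (setIidPr UG) subnK // subset_leq_card.
apply: leq_trans le _; apply: leq_trans (leq_mul (leqnn _) (IHm _ _)) _.
  by apply: leq_trans Gm; rewrite -cU -addn1 leq_add2l.
rewrite -expnD leq_exp2l // addnC (@big_cat_nat _ _ _ #|G :\: U|.+1 _ #|G|.+1) //=;
  last by rewrite ltnS -cU leq_addr.
rewrite leq_add2l; apply: leq_trans
  (_ : \sum_(#|G :\: U|.+1 <= i < #|G|.+1) weight (lvl (#|V| ^ q) #|G|) <= _).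
  by rewrite sum_nat_const_nat -cU subSS addKn.
rewrite big_seq_cond [X in _ <= X]big_seq_cond; apply: leq_sum => i.
rewrite mem_index_iota ltnS => /andP[/andP[_ iG] _].
rewrite leq_mul2l; apply/orP; right; rewrite leq_add2l leq_mul2l; apply/orP; right.
by rewrite leq_add2r lvl_anti.
Qed.

Lemma goodcol_bound : 0 < Q ->
  #|goodcol V q k| <= 2 ^ (#|V| ^ q * (1 + E * (1 + B + 60 * D * q) * Q)).
Proof.
move=> Q0; set N := #|V| ^ q.
pose unif := [set G : {set {set V}} | [forall e in G, #|e| == q]].
have cunif : #|unif| <= 2 ^ N.
  apply: leq_trans (_ : #|powerset [set f : {set V} | #|f| == q]| <= _).
    apply/subset_leq_card/subsetP => G; rewrite inE => /forall_inP Gq.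
    by rewrite powersetE; apply/subsetP => e /Gq; rewrite inE.
  by rewrite card_powerset leq_exp2l // card_uniform.
have gb G : G \in unif -> #|good_on q k G| <= 2 ^ (N * (E * (1 + B + 60 * D * q) * Q)).
  rewrite inE => /forall_inP Gq; apply: leq_trans (good_on_bound G) _.
  rewrite leq_exp2l // -/N.
  have GN : #|G| <= N.
    apply: leq_trans (card_uniform V q); apply/subset_leq_card/subsetP => e /Gq.
    by rewrite inE.
  apply: leq_trans (_ : \sum_(1 <= i < N.+1) weight (lvl N i) <= _).
    by rewrite [X in _ <= X](@big_cat_nat _ _ _ #|G|.+1) //= leq_addr.
  rewrite /weight -big_distrr /= big_split /= -big_distrr /=.
  rewrite (big_split _ _ _ _ (fun=> 3)) /= !sum_nat_const_nat !subSS !subn0.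
  (* The average level is at most 2, so 60 is [12 * (2 + 3)]. *)
  have := sum_lvl N; move: (\sum_(1 <= i < N.+1) lvl N i) => S SN.
  rewrite -(mulnA E) mulnCA leq_mul2l; apply/orP; right.
  apply: leq_trans (_ : N * (1 + B) + 12 * D * q * Q * (2 * N + N * 3) <= _).
    by rewrite leq_add2l leq_mul2l leq_add2r SN orbT.
  have -> : 12 * D * q * Q * (2 * N + N * 3) = N * (60 * D * q * Q) by nia.
  rewrite -mulnDr leq_mul2l; apply/orP; right.
  by rewrite [X in _ <= X]mulnDl leq_add2r leq_pmulr.
rewrite -sum1_card (partition_big (@supp V) predT) //=.
apply: leq_trans (_ : \sum_(G in unif) 2 ^ (N * (E * (1 + B + 60 * D * q) * Q)) <= _).
  rewrite [X in _ <= X]big_mkcond; apply: leq_sum => G _.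
  have cE : \sum_(chi in goodcol V q k | supp chi == G) 1 = #|good_on q k G|.
    by rewrite -sum1_card; apply: eq_bigl => chi; rewrite [in RHS]inE.
  rewrite cE; case: ifPn => [/gb //|nG].
  rewrite leqn0 cards_eq0; apply/eqP/setP => chi; rewrite [RHS]inE.
  apply: contraNF nG; rewrite inE => /andP[cg /eqP<-]; rewrite inE.
  apply/forall_inP => e; rewrite inE; case ce: (chi e) => [z|//] _.
  by have [->] := goodcolP cg ce.
by rewrite sum_nat_const (mulnDr N) expnD muln1 leq_mul2r cunif orbT.
Qed.

End GoodColorings.

(** * Reduction to colourings *)

(* Edges of H serve as their own, pairwise distinct, colours. *)
Lemma free_degenerate (V : finType) r k (H : {set {set V}}) : 2 < r -> 2 < k ->
  Defs.rgraph r H -> ~~ [exists C : {set {set V}}, (C \subset H) && loose_cycle r k C] ->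
  forall K : {set {set V}}, K \subset H -> K != set0 ->
  exists e, exists x, [/\ e \in K, x \in e
    & #|colors id K (e :\ x)| <= 2 * (k * r.+2)].
Proof.
move=> r2 k2 /forall_inP Hr noC K KH K0.
have Kr e : e \in K -> #|e| = r by move=> /(subsetP KH)/Hr/eqP.
have [/exists_inP[e eK /exists_inP[x xe le]]|no] :=
  boolP [exists e : {set V} in K, exists x in e,
    #|colors id K (e :\ x)| <= 2 * (k * r.+2)]; first by exists e, x.
have [|||||w [e [wI eK ee _ _]]] :=
  @full_rainbow_cycle V (V + {set V})%type inl inr K r (2 * (k * r.+2)) _ r2 Kr _ _ k k2.
- by move=> x y [].
- by [].
- move=> e x eK xe; rewrite ltnNge; apply: contraNN no => le.
  apply/exists_inP; exists e => //; apply/exists_inP; exists x => //.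
  apply: leq_trans le; rewrite -(card_imset _ (@inr_inj V {set V})).
  apply/subset_leq_card/subsetP => _ /imsetP[f /imsetP[g gK ->] ->].
  exact: imset_f.
- by [].
- by [].
exfalso; move/existsPn: noC => /(_ [set e i | i : 'I_k]) /negP; apply.
apply/andP; split.
  by apply/subsetP => _ /imsetP[i _ ->]; apply: (subsetP KH); case: (eK i).
apply: (loose_cycle_core k2 wI) => [i|i|i|//]; have [eiK wi wi'] := eK i => //.
exact: Kr.
Qed.

(** With edges as their own colours, [elimination] puts each edge on the list of one of its
    [q]-subsets. The [i]-th colouring sends [f] to the vertex completing it to the [i]-th edge of
    its list; its extension lies in [H], hence has no cycle. *)
Lemma Forb_bound n q k : 1 < q -> 2 < k ->
  #|Forb q.+1 (@loose_cycle 'I_n q.+1 k)| <= #|goodcol 'I_n q k| ^ (2 * (k * q.+3)).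
Proof.
move=> q1 k2; set d := 2 * _.
rewrite -[d in _ ^ d]card_ord -card_ffun_on.
pose un (p : {ffun 'I_d -> {ffun {set 'I_n} -> option 'I_n}}) := \bigcup_i ext (p i).
apply: leq_trans (leq_imset_card un _).
apply/subset_leq_card/subsetP => H; rewrite inE => /andP[Hr noC].
have Hq e : e \in H -> #|e| = q.+1 by move/forall_inP: Hr => /[apply]/eqP.
have [lam [lamd lamP]] := elimination Hq (@free_degenerate _ q.+1 k H q1 k2 Hr noC).
pose l (f : {set 'I_n}) := enum [set e in lam f | (e \in H) && (f \subset e)].
pose p : {ffun 'I_d -> {ffun {set 'I_n} -> option 'I_n}} :=
  [ffun i : 'I_d => [ffun f : {set 'I_n} =>
    (* Beyond the end of the list the default [set0] yields [None]. *)
    if #|f| == q then [pick x in nth set0 (l f) i :\: f] else None]].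
have pP i f z : p i f = Some z -> [/\ #|f| = q, z \notin f & z |: f \in H].
  rewrite !ffunE; case: eqP => // fq; case: pickP => // x /setDP[xe xf] [<-].
  have [le|lt] := leqP (size (l f)) i; first by rewrite nth_default ?inE in xe.
  have := mem_nth set0 lt; rewrite mem_enum inE => /and3P[_ eH fe].
  split=> //; rewrite (_ : _ |: f = nth set0 (l f) i) //.
  apply/eqP; rewrite eqEcard subUset sub1set xe fe /=.
  by rewrite (Hq _ eH) cardsU1 xf fq.
have extH i : ext (p i) \subset H.
  apply/subsetP => e; rewrite inE => /existsP[f /existsP[z /andP[/eqP pf /eqP->]]].
  by have [] := pP i f z pf.
apply/imsetP; exists p.
  apply/ffun_onP => i; rewrite inE; apply/andP; split.
    apply/forallP => f; apply/forallP => z; apply/implyP => /eqP /pP[-> -> _].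
    by rewrite eqxx.
  apply: contraNN noC => /existsP[C /andP[Cs cyc]]; apply/existsP; exists C.
  by rewrite cyc andbT (subset_trans Cs).
apply/eqP; rewrite eqEsubset; apply/andP; split; last first.
  by apply/bigcupsP => i _; apply: extH.
apply/subsetP => e eH; have [x xe el] := lamP e eH.
have fq : #|e :\ x| = q by move: (Hq e eH); rewrite (cardsD1 x) xe add1n => -[].
have ein : e \in l (e :\ x) by rewrite mem_enum inE el eH subD1set.
have lt : index e (l (e :\ x)) < d.
  apply: leq_trans (lamd (e :\ x)); apply: leq_trans (_ : size (l (e :\ x)) <= _).
    by rewrite index_mem.
  by rewrite -cardE; apply/subset_leq_card/subsetP => g /[!inE] /andP[].
apply/bigcupP; exists (Ordinal lt) => //; rewrite inE.
apply/existsP; exists (e :\ x); apply/existsP; exists x.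
rewrite setD1K // eqxx andbT !ffunE fq eqxx nth_index //.
case: pickP => [y /setDP[ye]|/(_ x)]; last by rewrite !inE eqxx xe.
by rewrite !inE ye andbT negbK => /eqP->.
Qed.

(** * The exponent *)

Lemma box_coverable_exists q k : (1 < q)%N -> (2 < k)%N -> (q = 2 -> ~~ odd k) ->
  exists D E, [/\ 0 < D, 0 < E & box_coverable q k D E]%N.
Proof.
move=> q1 k2 qk; have [q2|q2] := eqVneq q 2.
  exists (5 * k ^ 2).+1, ((5 * k ^ 2).+1 ^ 2)%N; rewrite expn_gt0 q2; split=> //.
  by apply: box_coverable_2 => //; apply: qk.
have q3 : (2 < q)%N by rewrite ltn_neqAle eq_sym q2.
exists (2 * (k * q.+2))%N, 1%N; split=> //; last exact: box_coverable_ge3.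
by rewrite !muln_gt0 /= (leq_trans _ k2).
Qed.

Lemma floor_root m L : (0 < m)%N -> (0 < L)%N ->
  exists T, [/\ 0 < T, T ^ m <= L & L < T.+1 ^ m]%N.
Proof.
move=> m0 L0.
have ex : exists T, (T ^ m <= L)%N by exists 1%N; rewrite exp1n.
have ub T : (T ^ m <= L)%N -> (T <= L)%N.
  apply: leq_trans; case: T => // T.
  by rewrite -[X in (X <= _)%N]expn1 leq_pexp2l.
case: (ex_maxnP ex ub) => T TL Tmax; exists T; split=> //.
  by apply: Tmax; rewrite exp1n.
by rewrite ltnNge; apply/negP => /Tmax; rewrite ltnn.
Qed.

Lemma Forb_exponent q k : (1 < q)%N -> (2 < k)%N -> (q = 2 -> ~~ odd k) ->
  exists C, forall n, (2 <= n)%N -> exists T,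
    let L := trunc_log 2 n in
    [/\ 0 < T, T ^ q.-1 <= L, L < T.+1 ^ q.-1 &
      #|Forb q.+1 (@loose_cycle 'I_n q.+1 k)| <= 2 ^ (n ^ q * (C * (L.+1 %/ T).+1))]%N.
Proof.
move=> q1 k2 qk; have [D [E [D0 E0 cov]]] := box_coverable_exists q1 k2 qk.
pose B := (q * D)%N; pose d := (2 * (k * q.+3))%N.
exists (d * (1 + E * (1 + B + 60 * D * q)))%N => n n2.
set L := trunc_log 2 n.
have L0 : (0 < L)%N by rewrite trunc_log_gt0.
have q10 : (0 < q.-1)%N by rewrite -ltnS prednK // ltnW.
have [T [T0 TL LT]] := floor_root q10 L0.
exists T; split=> //; set Q := (L.+1 %/ T).+1.
have LQT : (L.+1 <= Q * T)%N by apply/ltnW/ltn_ceil.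
have := @goodcol_bound 'I_n q k D E B L T Q D0 E0 q1 cov (ltnW (ltn_expl _ _)).
have nL : (n <= 2 ^ L.+1)%N by rewrite ltnW // trunc_log_ltn.
rewrite card_ord trunc_logP ?(ltnW n2) //.
move=> /(_ isT isT nL T0 TL LQT isT) le.
apply: leq_trans (Forb_bound n q1 k2) _; rewrite -/d.
have d0 : (0 < d)%N by rewrite !muln_gt0 /= (leq_trans _ k2).
apply: (@leq_trans ((2 ^ (n ^ q * (1 + E * (1 + B + 60 * D * q) * Q))) ^ d)%N).
  by rewrite leq_exp2r.
rewrite -expnM leq_exp2l // -mulnA leq_mul2l; apply/orP; right.
rewrite (mulnC _ d) -(mulnA d) leq_mul2l; apply/orP; right.
by rewrite [X in (_ <= X)%N]mulnDl leq_add2r leq_pmulr.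
Qed.

Import Order.TTheory GRing.Theory Num.Theory.
Local Open Scope ring_scope.

Lemma exponent_bound (R : realType) n m L T :
  (2 <= n)%N -> (0 < m)%N -> L = trunc_log 2 n ->
  (0 < T)%N -> (T ^ m <= L)%N -> (L < T.+1 ^ m)%N ->
  ((L.+1 %/ T).+1)%:R <= 8 * log2 (n%:R : R) `^ ((m%:R - 1) / m%:R).
Proof.
move=> n2 m0 LE T0 TL LT; set x := log2 _.
have ln2 : 0 < ln 2 :> R by rewrite ln_gt0 // ltr1n.
have Llog a b : (0 < a)%N -> (2 ^ a <= b)%N -> a%:R <= log2 (b%:R : R).
  move=> a0 ab; rewrite /log2 ler_pdivlMr // mulr_natl -lnXn ?ltr0n //.
  by rewrite ler_ln ?posrE ?exprn_gt0 ?ltr0n // -?natrX ?ler_nat // (leq_trans _ ab) // expn_gt0.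
have L0 : (0 < L)%N by rewrite LE trunc_log_gt0.
have Lx : L%:R <= x by apply: Llog => //; rewrite LE trunc_logP // ltnW.
have x1 : 1 <= x by apply: le_trans Lx; rewrite ler1n.
have x0 : 0 < x by apply: lt_le_trans x1.
have xL : x <= L.+1%:R.
  rewrite /x /log2 ler_pdivrMr // mulr_natl -lnXn ?ltr0n //.
  rewrite ler_ln ?posrE ?exprn_gt0 ?ltr0n //; last by rewrite ltnW.
  by rewrite -natrX ler_nat LE ltnW // trunc_log_ltn.
have m0R : m%:R != 0 :> R by rewrite pnatr_eq0 -lt0n.
have rT : x `^ (m%:R^-1) <= (2 * T)%:R.
  apply: le_trans (_ : ((2 * T)%:R ^+ m) `^ (m%:R^-1) <= _); last first.
    by rewrite -powR_mulrn // -powRrM mulfV // powRr1.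
  rewrite ge0_ler_powR ?nnegrE ?invr_ge0 ?exprn_ge0 ?(ltW x0) //.
  apply: le_trans xL _; rewrite -natrX ler_nat; apply: leq_trans LT _.
  by rewrite leq_exp2r // mul2n -addnn -addn1 leq_add2l.
have TL' : (T <= L)%N.
  apply: leq_trans TL; rewrite -[X in (X <= _)%N]expn1.
  by case: (T) T0 => // t _; rewrite leq_pexp2l.
have split_exp : x `^ ((m%:R - 1) / m%:R) * x `^ (m%:R^-1) = x.
  rewrite -powRD; last by rewrite (gt_eqF x0) implybT.
  by rewrite mulrBl mulfV // mul1r subrK powRr1 // ltW.
have y0 : 0 <= x `^ ((m%:R - 1) / m%:R) by apply: powR_ge0.
have T0R : 0 < T%:R :> R by rewrite ltr0n.
rewrite -(ler_pM2r T0R).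
apply: le_trans (_ : (4 * x) <= _).
  apply: le_trans (_ : (L.+1 + T)%:R <= _).
    by rewrite -natrM ler_nat mulSn addnC leq_add2r leq_divM.
  apply: le_trans (_ : (4 * L)%:R <= _); first by rewrite ler_nat; lia.
  by rewrite natrM ler_wpM2l.
rewrite -{1}split_exp; move: rT y0; rewrite natrM.
set y := x `^ (_ / _); set z := x `^ _; set t := T%:R => rT y0.
have -> : 8 * y * t = 4 * (y * (2 * t)) by ring.
by rewrite ler_wpM2l // ler_wpM2l.
Qed.


Theorem theorem1p2 (R : realType) (r k : nat) (hr : (3 <= r)%N) (hk : (3 <= k)%N) :
  exists c : R, forall n : nat, (2 <= n)%N ->
    (r = 3%N -> ~~ odd k ->
       #|Forb r (@loose_cycle 'I_n r k)|%:R < 2 `^ (c * n%:R ^+ 2)) /\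
    ((3 < r)%N ->
       #|Forb r (@loose_cycle 'I_n r k)|%:R <
         2 `^ (c * n%:R ^+ (r - 1) *
               log2 (n%:R : R) `^ ((r%:R - 3) / (r%:R - 2)))).
Proof.
have [r3k|ok] := boolP ((r == 3)%N && odd k).
  (* For [r = 3] and odd [k] both implications are vacuous. *)
  exists 0 => n _; case/andP: r3k => /eqP-> ->; split=> //.
have rE : r = (r - 1).+1 by rewrite subn1 prednK // ltnW // ltnW.
have q1 : (1 < r - 1)%N by rewrite -ltnS -rE.
have qk : (r - 1)%N = 2 -> ~~ odd k.
  by move=> q2; move: ok; rewrite rE q2.
have [C HC] := Forb_exponent q1 hk qk.
(* The 8 comes from [exponent_bound]; the added 1 makes the inequality strict. *)
exists (8 * C%:R + 1) => n n2.
have [T [T0 TL LT]] := HC n n2; rewrite -rE => le.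
set x := log2 (n%:R : R); set y := x `^ ((r%:R - 3) / (r%:R - 2)).
(* For [r = 3] the logarithm has exponent 0, so [y] is 1 and both bounds are this inequality. *)
suff lt : #|Forb r (@loose_cycle 'I_n r k)|%:R <
    2 `^ ((8 * C%:R + 1) * n%:R ^+ (r - 1) * y).
  split=> // r3 _; move: lt; rewrite /y r3 subrr mul0r powRr0 mulr1.
  by rewrite subn1.
have mE : (r - 1).-1%:R = r%:R - 2 :> R.
  by rewrite -subn1 -subnDA natrB // ltnW.
have m0 : (0 < (r - 1).-1)%N by rewrite -ltnS prednK // ltnW.
have := @exponent_bound R n (r - 1).-1 (trunc_log 2 n) T n2 m0 erefl T0 TL LT.
rewrite mE; have -> : r%:R - 2 - 1 = r%:R - 3 :> R by ring.
rewrite -/x -/y => Qy.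
have x0 : 0 < x.
  by rewrite divr_gt0 // ln_gt0 // ltr1n.
have y0 : 0 < y by apply: powR_gt0.
have n0 : 0 < n%:R ^+ (r - 1) :> R by rewrite exprn_gt0 // ltr0n ltnW.
apply: (@le_lt_trans _ _ (2 `^ (n ^ (r - 1) * (C * ((trunc_log 2 n).+1 %/ T).+1))%:R)).
  by rewrite powR_mulrn // -natrX ler_nat.
rewrite /powR pnatr_eq0 /= ltr_expR ltr_pM2r ?ln_gt0 ?ltr1n //.
apply: (@le_lt_trans _ _ (n%:R ^+ (r - 1) * (C%:R * (8 * y)))).
  by rewrite !natrM natrX ler_wpM2l ?(ltW n0) // ler_wpM2l.
rewrite -subr_gt0.
have -> : (8 * C%:R + 1) * n%:R ^+ (r - 1) * y - n%:R ^+ (r - 1) * (C%:R * (8 * y))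
  = n%:R ^+ (r - 1) * y by ring.
by rewrite mulr_gt0.
Qed.
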